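(* For every nonzero real number $x$, $$\left.\frac{\partial W_{\alpha,\beta}(x)}{\partial\beta}\right|_{\alpha=1,\ \beta=2}=\frac{2K_1(2\sqrt x)-\ln x\,I_1(2\sqrt x)}{2\sqrt x}-\frac{I_0(2\sqrt x)}{2x}.$$
   Context: The Wright function is $W_{\alpha,\beta}(x)=\sum_{k=0}^\infty\frac{x^k}{k!\,\Gamma(\alpha k+\beta)}$ (with $1/\Gamma=0$ at the poles of $\Gamma$). $I_\nu$ and $K_\nu$ are the modified Bessel functions of the first and second kind. For $x<0$, $\ln x$ and $\sqrt x$ denote principal branches. *)

(* Defs.v *)
From Stdlib Require Import Reals ZArith.
From Coquelicot Require Export Coquelicot.

Local Open Scope C_scope.

(** * Elementary functions of a complex variable *)

Definition Cexp (z : C) : C := (exp (Re z) * cos (Im z), exp (Re z) * sin (Im z))%R.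

Definition Csin (z : C) : C := (Cexp (Ci * z) - Cexp (- (Ci * z))) / (RtoC 2 * Ci).

(* Principal argument, with values in (-PI, PI]; it is PI on the negative
   real axis. *)
Definition Carg (z : C) : R :=
  if Rle_dec 0 (Im z) then acos (Re z / Cmod z) else (- acos (Re z / Cmod z))%R.

(* Principal branches, discontinuous across the negative real axis.
   [Clog 0] and [Cpower 0 w] are junk values. *)
Definition Clog (z : C) : C := (ln (Cmod z), Carg z).

Definition Csqrt (z : C) : C := RtoC (sqrt (Cmod z)) * Cexp (Ci * RtoC (Carg z / 2)).

Definition Cpower (z w : C) : C := Cexp (w * Clog z).

(* Sum of a convergent complex series. *)
Definition Cseries (a : nat -> C) : C :=
  iota (T := C_CompleteNormedModule)
       (is_series (K := C_AbsRing) (V := C_NormedModule) a).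

(** * The Gamma function *)

(* Euler's integral of the second kind, meaningful for [0 < Re z]. *)
Definition Gamma_integral (z : C) : C :=
  RInt_gen (V := C_R_CompleteNormedModule)
    (fun t : R => Cpower (RtoC t) (z - RtoC 1) * RtoC (exp (- t)))
    (at_right 0) (Rbar_locally p_infty).

(* [Cpochhammer z n] is [z (z + 1) ... (z + n - 1)]. *)
Fixpoint Cpochhammer (z : C) (n : nat) : C :=
  match n with
  | O => RtoC 1
  | S m => Cpochhammer z m * (z + RtoC (INR m))
  end.

(* The entire function [1 / Gamma], where [Gamma] is continued to the left by
   [Gamma z = Gamma (z + n) / (z (z + 1) ... (z + n - 1))].  The shift [n] below
   satisfies [0 < Re z + n] (and is [0] if [0 < Re z]).  At the poles
   0, -1, -2, ... the Pochhammer factor vanishes, so the value is [0]. *)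
Definition rGamma (z : C) : C :=
  let n := Z.to_nat (up (- Re z)) in
  Cpochhammer z n / Gamma_integral (z + RtoC (INR n)).

(** * Special functions *)

Definition Wright (alpha beta x : C) : C :=
  Cseries (fun k : nat =>
    x ^ k / RtoC (INR (fact k)) * rGamma (alpha * RtoC (INR k) + beta)).

(* [z <> 0] is assumed, the power [(z / 2) ^ nu] being the principal one. *)
Definition BesselI (nu z : C) : C :=
  Cpower (z / RtoC 2) nu *
  Cseries (fun k : nat =>
    (z ^ 2 / RtoC 4) ^ k / RtoC (INR (fact k)) * rGamma (nu + RtoC (INR k) + RtoC 1)).

Definition BesselK_quotient (nu z : C) : C :=
  RtoC (PI / 2) * ((BesselI (- nu) z - BesselI nu z) / Csin (nu * RtoC PI)).

(* [Csin (nu * PI) = 0] exactly when [nu] is an integer; there [K] is defined as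
   the limit of the quotient as the order tends to [nu], [locally' nu] being the
   filter of punctured neighbourhoods of [nu]. *)
Definition BesselK (nu z : C) : C :=
  if Ceq_dec (Csin (nu * RtoC PI)) (RtoC 0) then
    iota (T := C_CompleteNormedModule)
      (fun l : C =>
         filterlim (fun mu : C => BesselK_quotient mu z) (locally' nu) (locally l))
  else BesselK_quotient nu z.

(* Main.v *)
Require Import Defs.
From Stdlib Require Import Reals Lra Lia ZArith.
From Coquelicot Require Import Coquelicot.

(** Write [W b] for [Wright 1 b x], [s] for [Csqrt x] and [L] for [Clog s], so that
    [Clog x = 2 L] and [s * s = x].  Comparing the defining series gives
    [I_nu (2 s) = exp (nu L) W (nu + 1)] ([BesselI_Wright]).  Since
    [1 / Gamma(z) = z / Gamma(z + 1)] ([rGamma_succ]), splitting the factor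
    [b + k] in every term yields the contiguity relation
    [W b = b W (b + 1) + x W (b + 2)] ([Wright_1_rec]).  At [b = 0] it gives
    [W 0 = x W 2], that is [I_(-1) = I_1], and [W' 0 = W 1 + x W' 2].

    Order 1 is a removable singularity of the quotient that defines [K], whose
    denominator [sin (mu PI)] has derivative [- PI] there.  By L'Hopital's rule
    ([BesselK_1]),
    [K_1 = - (1/2) d/dmu (I_(-mu) - I_mu) = s (L W 2 + W' 2) + W 1 / (2 s)]
    at argument [2 s].  In the claimed right-hand side the terms in [L] cancel
    against [ln x I_1], the terms in [W 1 = I_0] cancel against [I_0 / (2 x)], and
    [W' 2] is what remains.

    The analytic content is therefore that [W] is complex differentiable at 2
    and at 0.  By the contiguity relation it suffices to treat the integers
    [n >= 2].  There [W b] is [1 / Gamma(b)] times the sum of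
    [x ^ k / (k! (b)_k)], where [(b)_k] is the Pochhammer symbol.

    - The second factor is differentiated term by term: on [1 <= Re b] every
      [1 / (b + j)] is bounded by 1, and this makes the second-order Taylor
      remainder of [1 / (b)_k] at most [4 ^ k] times the square of the increment
      ([inv_Cpochhammer_taylor]).
    - For the first factor, Euler's integral is differentiated under the integral
      sign where [1 < Re b] ([is_Cderive_Gamma_integral]).  With
      [|exp z - 1 - z| <= |z|^2 exp |z|], the remainder of the integrand is
      dominated by a multiple of [exp (- t / 2)] ([log_weight_bound]).
      Nonvanishing is needed only at the positive integers, where it follows from
      [Gamma 1 = 1] and the recurrence. *)

Local Open Scope C_scope.
Set Bullet Behavior "Strict Subproofs".

Local Notation is_Cderive := (@is_derive C_AbsRing C_NormedModule).

(** * Complex derivatives *)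

Lemma locally_C_intro (P : C -> Prop) (a : C) (d : R) :
  (0 < d)%R -> (forall y, (Cmod (y - a) < d)%R -> P y) ->
  locally (T := C_UniformSpace) a P.
Proof.
  intros Hd H.
  apply filter_imp with (2 := locally_ball_norm (V := C_NormedModule) a (mkposreal d Hd)).
  intros y Hy; apply H, Hy.
Qed.

Lemma locally_C_AbsRing_intro (P : C -> Prop) (a : C) (d : R) :
  (0 < d)%R -> (forall y, (Cmod (y - a) < d)%R -> P y) ->
  locally (T := AbsRing_UniformSpace C_AbsRing) a P.
Proof. intros Hd H; exists (mkposreal d Hd); intros y Hy; apply H, Hy. Qed.

Lemma locally_C_AbsRing_elim (P : C -> Prop) (a : C) :
  locally (T := AbsRing_UniformSpace C_AbsRing) a P ->
  exists d, (0 < d)%R /\ forall y, (Cmod (y - a) < d)%R -> P y.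
Proof. intros [d Hd]; exists d; split; [apply cond_pos | intros y Hy; apply Hd, Hy]. Qed.

Lemma is_Cderive_bound (f : C -> C) (a l : C) :
  (forall eps : posreal, exists d, (0 < d)%R /\
     forall y, (Cmod (y - a) < d)%R ->
       (Cmod (f y - f a - (y - a) * l) <= eps * Cmod (y - a))%R) ->
  is_Cderive f a l.
Proof.
  intros H; split.
  - apply is_linear_scal_l.
  - intros y Hy eps.
    assert (E : y = a).
    { symmetry; apply (is_filter_lim_locally_unique (V := AbsRing_NormedModule C_AbsRing) a y Hy). }
    rewrite E; destruct (H eps) as [d [Hd K]].
    apply locally_C_AbsRing_intro with d; [exact Hd | intros z Hz; exact (K z Hz)].
Qed.

Lemma is_Cderive_elim (f : C -> C) (a l : C) :
  is_Cderive f a l ->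
  forall eps : posreal, exists d, (0 < d)%R /\
     forall y, (Cmod (y - a) < d)%R ->
       (Cmod (f y - f a - (y - a) * l) <= eps * Cmod (y - a))%R.
Proof.
  intros [_ H] eps.
  apply locally_C_AbsRing_elim.
  exact (H a (fun P HP => HP) eps).
Qed.

Lemma is_Cderive_quadratic (f : C -> C) (a l : C) (d M : R) :
  (0 < d)%R ->
  (forall y, (Cmod (y - a) < d)%R ->
     (Cmod (f y - f a - (y - a) * l) <= M * Cmod (y - a) ^ 2)%R) ->
  is_Cderive f a l.
Proof.
  intros Hd H; apply is_Cderive_bound; intros eps.
  assert (HM : (0 < Rabs M + 1)%R) by (pose proof (Rabs_pos M); lra).
  assert (He : (0 < eps / (Rabs M + 1))%R)
    by (apply Rdiv_lt_0_compat; [apply cond_pos | exact HM]).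
  exists (Rmin d (eps / (Rabs M + 1))); split; [apply Rmin_pos; assumption |].
  intros y Hy.
  pose proof (Rmin_l d (eps / (Rabs M + 1))) as H1.
  pose proof (Rmin_r d (eps / (Rabs M + 1))) as H2.
  apply Rle_trans with (1 := H y (Rlt_le_trans _ _ _ Hy H1)).
  pose proof (Cmod_ge_0 (y - a)) as H0.
  assert (H3 : ((Rabs M + 1) * Cmod (y - a) <= eps)%R).
  { apply Rle_trans with ((Rabs M + 1) * (eps / (Rabs M + 1)))%R.
    - apply Rmult_le_compat_l; lra.
    - right; field; lra. }
  pose proof (Rle_abs M); nra.
Qed.

Lemma is_Cderive_ext_loc (f g : C -> C) (a l : C) (d : R) :
  (0 < d)%R -> (forall y, (Cmod (y - a) < d)%R -> f y = g y) ->
  is_Cderive f a l -> is_Cderive g a l.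
Proof.
  intros Hd H; apply is_derive_ext_loc.
  apply locally_C_AbsRing_intro with d; assumption.
Qed.

Lemma is_Cderive_eq (f : C -> C) (a l l' : C) :
  is_Cderive f a l -> l = l' -> is_Cderive f a l'.
Proof. intros H <-; exact H. Qed.

(** The ring [C_AbsRing] seen as a module over itself and [C_NormedModule] carry
    the same norm, but the generic rules for derivatives of products speak of
    the former. *)
Lemma is_Cderive_of_AbsRing (f : C -> C) (a l : C) :
  is_derive (V := AbsRing_NormedModule C_AbsRing) f a l <-> is_Cderive f a l.
Proof.
  split; intros [_ H]; split; try apply is_linear_scal_l; exact H.
Qed.

Lemma is_Cderive_const (c a : C) : is_Cderive (fun _ => c) a (RtoC 0).
Proof. exact (is_derive_const (V := C_NormedModule) c a). Qed.

Lemma is_Cderive_id (a : C) : is_Cderive (fun z => z) a (RtoC 1).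
Proof. apply is_Cderive_of_AbsRing; exact (is_derive_id (K := C_AbsRing) a). Qed.

Lemma is_Cderive_plus (f g : C -> C) (a l m : C) :
  is_Cderive f a l -> is_Cderive g a m -> is_Cderive (fun z => f z + g z) a (l + m).
Proof. exact (is_derive_plus (V := C_NormedModule) f g a l m). Qed.

Lemma is_Cderive_minus (f g : C -> C) (a l m : C) :
  is_Cderive f a l -> is_Cderive g a m -> is_Cderive (fun z => f z - g z) a (l - m).
Proof. exact (is_derive_minus (V := C_NormedModule) f g a l m). Qed.

Lemma is_Cderive_mult (f g : C -> C) (a l m : C) :
  is_Cderive f a l -> is_Cderive g a m ->
  is_Cderive (fun z => f z * g z) a (l * g a + f a * m).
Proof.
  intros Hf%is_Cderive_of_AbsRing Hg%is_Cderive_of_AbsRing.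
  apply is_Cderive_of_AbsRing.
  exact (is_derive_mult (K := C_AbsRing) f g a l m Hf Hg Cmult_comm).
Qed.

Lemma is_Cderive_comp (f g : C -> C) (a l m : C) :
  is_Cderive f (g a) l -> is_Cderive g a m ->
  is_Cderive (fun z => f (g z)) a (m * l).
Proof.
  intros Hf Hg%is_Cderive_of_AbsRing.
  exact (is_derive_comp (V := C_NormedModule) f g a l m Hf Hg).
Qed.

Lemma is_Cderive_scal (f : C -> C) (c a l : C) :
  is_Cderive f a l -> is_Cderive (fun z => c * f z) a (c * l).
Proof.
  intros H.
  apply is_Cderive_eq with (RtoC 0 * f a + c * l); [| ring].
  apply is_Cderive_mult; [apply is_Cderive_const | exact H].
Qed.

Lemma is_Cderive_shift (f : C -> C) (c a l : C) :
  is_Cderive f (a + c) l -> is_Cderive (fun z => f (z + c)) a l.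
Proof.
  intros H; apply is_Cderive_eq with ((RtoC 1 + RtoC 0) * l); [| ring].
  apply (is_Cderive_comp f (fun z => z + c)); [exact H |].
  apply is_Cderive_plus; [apply is_Cderive_id | apply is_Cderive_const].
Qed.

Lemma Cmod_minus_sym (a b : C) : Cmod (a - b) = Cmod (b - a).
Proof. rewrite <- Cmod_opp; f_equal; ring. Qed.

Lemma Cmod_triangle_inv (a b : C) : (Cmod a - Cmod (b - a) <= Cmod b)%R.
Proof.
  pose proof (Cmod_triangle b (a - b)) as H.
  replace (b + (a - b)) with a in H by ring.
  rewrite (Cmod_minus_sym b a); lra.
Qed.

Lemma is_Cderive_inv_at (a : C) :
  a <> RtoC 0 -> is_Cderive (fun z => / z) a (- / (a * a)).
Proof.
  intros Ha.
  assert (Hp : (0 < Cmod a)%R) by (apply Cmod_gt_0, Ha).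
  apply is_Cderive_quadratic with (Cmod a / 2)%R (2 / (Cmod a ^ 3))%R; [lra |].
  intros y Hy.
  pose proof (Cmod_triangle_inv a y) as Hy2.
  assert (Hy0 : y <> RtoC 0) by (apply Cmod_gt_0; lra).
  replace (/ y - / a - (y - a) * (- / (a * a)))
    with ((y - a) * (y - a) * / (y * (a * a))) by (field; auto).
  rewrite !Cmod_mult, Cmod_inv, !Cmod_mult by (repeat apply Cmult_neq_0; auto).
  replace (2 / Cmod a ^ 3 * Cmod (y - a) ^ 2)%R
    with (Cmod (y - a) * Cmod (y - a) * (2 / Cmod a ^ 3))%R by ring.
  apply Rmult_le_compat_l; [pose proof (Cmod_ge_0 (y - a)); nra |].
  replace (2 / Cmod a ^ 3)%R with (/ (Cmod a / 2 * (Cmod a * Cmod a)))%R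
    by (field; lra).
  apply Rinv_le_contravar; [repeat apply Rmult_lt_0_compat; lra |].
  apply Rmult_le_compat_r; nra.
Qed.

Lemma is_Cderive_inv (f : C -> C) (a l : C) :
  is_Cderive f a l -> f a <> RtoC 0 ->
  is_Cderive (fun z => / f z) a (- l / (f a * f a)).
Proof.
  intros Hf H0.
  apply is_Cderive_eq with (l * (- / (f a * f a))); [| unfold Cdiv; ring].
  apply (is_Cderive_comp (fun z => / z) f); [apply is_Cderive_inv_at, H0 | exact Hf].
Qed.

(** L'Hopital's rule at a common zero: numerator and denominator are, to first
    order, [(z - a) l] and [(z - a) m]. *)
Lemma filterlim_quotient_of_derive (f g : C -> C) (a l m : C) :
  is_Cderive f a l -> is_Cderive g a m -> f a = RtoC 0 -> g a = RtoC 0 ->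
  m <> RtoC 0 ->
  filterlim (fun z => f z / g z) (locally' (T := C_UniformSpace) a)
    (locally (T := C_UniformSpace) (l / m)).
Proof.
  intros Hf Hg Hfa Hga Hm.
  assert (Hmp : (0 < Cmod m)%R) by (apply Cmod_gt_0, Hm).
  apply (filterlim_locally_ball_norm (U := C_NormedModule)); intros eps.
  pose (K := (2 * (1 + Cmod l / Cmod m) / Cmod m)%R).
  assert (Hlm : (0 <= Cmod l / Cmod m)%R).
  { apply Rmult_le_pos; [apply Cmod_ge_0 | left; apply Rinv_0_lt_compat, Hmp]. }
  assert (HK : (0 < K)%R) by (apply Rdiv_lt_0_compat; lra).
  assert (He1 : (0 < Rmin (Cmod m / 2) (eps / (2 * K)))%R).
  { apply Rmin_pos; [lra | apply Rdiv_lt_0_compat; [apply cond_pos | lra]]. }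
  pose (e1 := mkposreal _ He1).
  assert (E1 : (e1 <= Cmod m / 2)%R) by apply Rmin_l.
  assert (E2 : (e1 * K <= eps / 2)%R).
  { apply Rle_trans with (eps / (2 * K) * K)%R.
    - apply Rmult_le_compat_r; [lra | apply Rmin_r].
    - right; field; lra. }
  destruct (is_Cderive_elim f a l Hf e1) as [d1 [Hd1 H1]].
  destruct (is_Cderive_elim g a m Hg e1) as [d2 [Hd2 H2]].
  apply locally_C_intro with (Rmin d1 d2); [apply Rmin_pos; assumption |].
  intros z Hz Hza.
  specialize (H1 z (Rlt_le_trans _ _ _ Hz (Rmin_l _ _))).
  specialize (H2 z (Rlt_le_trans _ _ _ Hz (Rmin_r _ _))).
  rewrite Hfa in H1; rewrite Hga in H2.
  set (h := z - a) in *.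
  assert (Hh : (0 < Cmod h)%R).
  { apply Cmod_gt_0; intros E; apply Hza.
    replace z with (h + a) by (unfold h; ring); rewrite E; apply Cplus_0_l. }
  (* the denominator stays away from 0 at rate |m h| / 2 *)
  assert (H3 : (Cmod m * Cmod h / 2 <= Cmod (g z))%R).
  { pose proof (Cmod_triangle_inv (h * m) (g z)) as T.
    replace (g z - h * m) with (g z - RtoC 0 - h * m) in T by ring.
    rewrite Cmod_mult in T; nra. }
  assert (Hg0 : g z <> RtoC 0) by (apply Cmod_gt_0; nra).
  change (Cmod (f z / g z - l / m) < eps)%R.
  replace (f z / g z - l / m)
    with (((f z - RtoC 0 - h * l) - (l / m) * (g z - RtoC 0 - h * m)) / g z)
    by (field; auto).
  rewrite Cmod_div by exact Hg0.
  assert (H4 : (Cmod ((f z - RtoC 0 - h * l) - (l / m) * (g z - RtoC 0 - h * m))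
               <= e1 * (1 + Cmod l / Cmod m) * Cmod h)%R).
  { unfold Cminus at 1.
    eapply Rle_trans; [apply Cmod_triangle |].
    rewrite Cmod_opp, Cmod_mult, Cmod_div by exact Hm.
    assert (Cmod l / Cmod m * Cmod (g z - RtoC 0 - h * m)
            <= Cmod l / Cmod m * (e1 * Cmod h))%R by (apply Rmult_le_compat_l; auto).
    lra. }
  apply Rle_lt_trans with (e1 * (1 + Cmod l / Cmod m) * Cmod h / (Cmod m * Cmod h / 2))%R.
  - unfold Rdiv at 1 3; apply Rmult_le_compat.
    + apply Cmod_ge_0.
    + left; apply Rinv_0_lt_compat; nra.
    + exact H4.
    + apply Rinv_le_contravar; nra.
  - replace (e1 * (1 + Cmod l / Cmod m) * Cmod h / (Cmod m * Cmod h / 2))%R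
      with (e1 * K)%R by (unfold K; field; lra).
    pose proof (cond_pos eps); lra.
Qed.

(** * Calculus of complex functions of a real variable *)

Lemma continuous_C (f : R -> C) (t : R) :
  continuous (fun u => Re (f u)) t -> continuous (fun u => Im (f u)) t ->
  continuous (T := R_UniformSpace) (U := C_UniformSpace) f t.
Proof.
  intros H1 H2; apply filterlim_locally; intros eps.
  pose proof (proj1 (filterlim_locally _ _) H1 eps) as K1.
  pose proof (proj1 (filterlim_locally _ _) H2 eps) as K2.
  apply filter_imp with (2 := filter_and _ _ K1 K2).
  intros u [A B]; split; assumption.
Qed.

Lemma is_RInt_C_derive (F f : R -> C) (a b : R) :
  (forall t, (Rmin a b <= t <= Rmax a b)%R ->
     is_derive (fun u => Re (F u)) t (Re (f t)) /\
     is_derive (fun u => Im (F u)) t (Im (f t)) /\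
     continuous (fun u => Re (f u)) t /\ continuous (fun u => Im (f u)) t) ->
  is_RInt (V := C_R_NormedModule) f a b (F b - F a).
Proof.
  intros H.
  apply (is_RInt_fct_extend_pair (U := R_NormedModule) (V := R_NormedModule)).
  - apply (is_RInt_derive (V := R_CompleteNormedModule) (fun u => Re (F u)) (fun u => Re (f u)));
      intros t Ht; apply (H t Ht).
  - apply (is_RInt_derive (V := R_CompleteNormedModule) (fun u => Im (F u)) (fun u => Im (f u)));
      intros t Ht; apply (H t Ht).
Qed.

(** * The complex exponential *)

Lemma Cexp_plus (z w : C) : Cexp (z + w) = Cexp z * Cexp w.
Proof.
  unfold Cexp, Re, Im; apply injective_projections; simpl;
    rewrite exp_plus, ?cos_plus, ?sin_plus; ring.
Qed.

Lemma Cexp_RtoC (x : R) : Cexp (RtoC x) = RtoC (exp x).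
Proof.
  unfold Cexp, RtoC, Re, Im; simpl; rewrite cos_0, sin_0; f_equal; ring.
Qed.

Lemma Cexp_0 : Cexp (RtoC 0) = RtoC 1.
Proof. rewrite Cexp_RtoC, exp_0; reflexivity. Qed.

Lemma Cexp_opp_l (z : C) : Cexp (- z) * Cexp z = RtoC 1.
Proof. rewrite <- Cexp_plus, <- Cexp_0; f_equal; ring. Qed.

Lemma Cexp_neq_0 (z : C) : Cexp z <> RtoC 0.
Proof.
  intros H; pose proof (Cexp_opp_l z) as K; rewrite H, Cmult_0_r in K.
  apply (f_equal fst) in K; simpl in K; lra.
Qed.

Lemma Cmod_Cexp (z : C) : Cmod (Cexp z) = exp (Re z).
Proof.
  unfold Cmod, Cexp; simpl.
  replace (exp (Re z) * cos (Im z) * (exp (Re z) * cos (Im z) * 1) +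
           exp (Re z) * sin (Im z) * (exp (Re z) * sin (Im z) * 1))%R
    with (Rsqr (exp (Re z)) * (Rsqr (sin (Im z)) + Rsqr (cos (Im z))))%R
    by (unfold Rsqr; ring).
  rewrite sin2_cos2, Rmult_1_r.
  apply sqrt_Rsqr; left; apply exp_pos.
Qed.

Lemma exp_le (x y : R) : (x <= y)%R -> (exp x <= exp y)%R.
Proof. intros [H | ->]; [left; apply exp_increasing, H | right; reflexivity]. Qed.

Lemma Re_le_Cmod (z : C) : (Re z <= Cmod z)%R.
Proof. apply Rle_trans with (2 := re_le_Cmod z); apply Rle_abs. Qed.

Lemma Cmod_C_R_norm (z : C) : norm (V := C_R_NormedModule) z = Cmod z.
Proof. symmetry; apply Cmod_norm. Qed.

Lemma Cmod_RInt_le_const (f : R -> C) (l : C) (M : R) :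
  is_RInt (V := C_R_NormedModule) f 0 1 l ->
  (forall t, (0 <= t <= 1)%R -> (Cmod (f t) <= M)%R) -> (Cmod l <= M)%R.
Proof.
  intros Hf H; rewrite <- Cmod_C_R_norm.
  replace M with (scal (1 - 0)%R M) by (unfold scal; simpl; unfold mult; simpl; ring).
  apply (norm_RInt_le f (fun _ => M) 0 1 l (scal (1 - 0)%R M)); [lra | | exact Hf |].
  - intros t Ht; rewrite Cmod_C_R_norm; apply H, Ht.
  - exact (is_RInt_const (V := R_NormedModule) 0 1 M).
Qed.

Lemma Cmod_Cexp_segment_le (z : C) (t : R) :
  (0 <= t <= 1)%R -> (Cmod (Cexp (RtoC t * z)) <= exp (Cmod z))%R.
Proof.
  intros Ht; rewrite Cmod_Cexp; apply exp_le.
  apply Rle_trans with (1 := Re_le_Cmod _).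
  rewrite Cmod_mult, Cmod_R, Rabs_pos_eq by lra.
  pose proof (Cmod_ge_0 z); nra.
Qed.

(** Both Taylor estimates integrate the derivative along the segment from 0
    to [z]. *)
Lemma Cexp_minus_1_bound (z : C) : (Cmod (Cexp z - RtoC 1) <= Cmod z * exp (Cmod z))%R.
Proof.
  apply Cmod_RInt_le_const with (f := fun t => z * Cexp (RtoC t * z)).
  - replace (Cexp z - RtoC 1) with (Cexp (RtoC 1 * z) - Cexp (RtoC 0 * z))
      by (rewrite Cmult_1_l, Cmult_0_l, Cexp_0; reflexivity).
    apply is_RInt_C_derive with (F := fun t => Cexp (RtoC t * z)).
    intros t _; destruct z as [a b].
    unfold Cexp, Re, Im; simpl; split; [| split; [| split]].
    1, 2: auto_derive; [exact I | unfold Rminus; ring].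
    all: apply (@ex_derive_continuous R_AbsRing R_NormedModule); auto_derive; exact I.
  - intros t Ht; rewrite Cmod_mult.
    apply Rmult_le_compat_l; [apply Cmod_ge_0 | apply Cmod_Cexp_segment_le, Ht].
Qed.

Lemma Cexp_minus_1_minus_bound (z : C) :
  (Cmod (Cexp z - RtoC 1 - z) <= Cmod z ^ 2 * exp (Cmod z))%R.
Proof.
  apply Cmod_RInt_le_const with (f := fun t => z * (Cexp (RtoC t * z) - RtoC 1)).
  - replace (Cexp z - RtoC 1 - z)
      with ((Cexp (RtoC 1 * z) - RtoC 1 * z) - (Cexp (RtoC 0 * z) - RtoC 0 * z))
      by (rewrite Cmult_1_l, Cmult_0_l, Cexp_0; ring).
    apply is_RInt_C_derive with (F := fun t => Cexp (RtoC t * z) - RtoC t * z).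
    intros t _; destruct z as [a b].
    unfold Cexp, Re, Im; simpl; split; [| split; [| split]].
    1, 2: auto_derive; [exact I | unfold Rminus; ring].
    all: apply (@ex_derive_continuous R_AbsRing R_NormedModule); auto_derive; exact I.
  - intros t Ht; rewrite Cmod_mult; simpl; rewrite Rmult_1_r, Rmult_assoc.
    apply Rmult_le_compat_l; [apply Cmod_ge_0 |].
    apply Rle_trans with (1 := Cexp_minus_1_bound _).
    rewrite Cmod_mult, Cmod_R, Rabs_pos_eq by lra.
    pose proof (Cmod_ge_0 z).
    apply Rmult_le_compat; [nra | left; apply exp_pos | nra | apply exp_le; nra].
Qed.

Lemma is_Cderive_Cexp (z : C) : is_Cderive Cexp z (Cexp z).
Proof.
  apply is_Cderive_quadratic with 1%R (Cmod (Cexp z) * exp 1)%R; [lra |].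
  intros y Hy.
  replace (Cexp y) with (Cexp z * Cexp (y - z)) by (rewrite <- Cexp_plus; f_equal; ring).
  replace (Cexp z * Cexp (y - z) - Cexp z - (y - z) * Cexp z)
    with (Cexp z * (Cexp (y - z) - RtoC 1 - (y - z))) by ring.
  rewrite Cmod_mult, Rmult_assoc.
  apply Rmult_le_compat_l; [apply Cmod_ge_0 |].
  apply Rle_trans with (1 := Cexp_minus_1_minus_bound _).
  rewrite Rmult_comm; apply Rmult_le_compat_r; [apply pow2_ge_0 | apply exp_le; lra].
Qed.

Lemma is_Cderive_Cexp_comp (f : C -> C) (a l : C) :
  is_Cderive f a l -> is_Cderive (fun z => Cexp (f z)) a (l * Cexp (f a)).
Proof.
  intros Hf; apply (is_Cderive_comp Cexp f); [apply is_Cderive_Cexp | exact Hf].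
Qed.

(** * Principal branches on the real line *)

Lemma Clog_pos (t : R) : (0 < t)%R -> Clog (RtoC t) = RtoC (ln t).
Proof.
  intros Ht; unfold Clog, Carg; rewrite Cmod_R, Rabs_pos_eq by lra; simpl.
  unfold RtoC; f_equal.
  destruct (Rle_dec 0 0) as [_ | n]; [| lra].
  replace (t / t)%R with 1%R by (field; lra); apply acos_1.
Qed.

Lemma Clog_neg (t : R) : (t < 0)%R -> Clog (RtoC t) = (ln (- t), PI).
Proof.
  intros Ht; unfold Clog, Carg; rewrite Cmod_R, Rabs_left by lra; simpl.
  f_equal.
  destruct (Rle_dec 0 0) as [_ | n]; [| lra].
  replace (t / - t)%R with (- (1))%R by (field; lra).
  rewrite acos_opp, acos_1; ring.
Qed.

Lemma Csqrt_pos (x : R) : (0 < x)%R -> Csqrt (RtoC x) = RtoC (sqrt x).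
Proof.
  intros Hx.
  pose proof (f_equal snd (Clog_pos x Hx)) as A; simpl in A.
  unfold Csqrt; rewrite A, Cmod_R, Rabs_pos_eq by lra.
  replace (Ci * RtoC (0 / 2)) with (RtoC 0)
    by (apply injective_projections; simpl; field).
  rewrite Cexp_0; ring.
Qed.

Lemma Csqrt_neg (x : R) : (x < 0)%R -> Csqrt (RtoC x) = Ci * RtoC (sqrt (- x)).
Proof.
  intros Hx.
  pose proof (f_equal snd (Clog_neg x Hx)) as A; simpl in A.
  unfold Csqrt; rewrite A, Cmod_R, Rabs_left by lra.
  replace (Cexp (Ci * RtoC (PI / 2))) with Ci; [ring |].
  unfold Cexp, Ci, Re, Im; simpl.
  replace (0 * (PI / 2) - 1 * 0)%R with 0%R by ring.
  replace (0 * 0 + 1 * (PI / 2))%R with (PI / 2)%R by ring.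
  rewrite exp_0, cos_PI2, sin_PI2; f_equal; ring.
Qed.

Lemma ln_sqrt (x : R) : (0 < x)%R -> ln (sqrt x) = (ln x / 2)%R.
Proof.
  intros Hx; pose proof (sqrt_lt_R0 x Hx) as H.
  rewrite <- (sqrt_sqrt x) at 2 by lra.
  rewrite ln_mult by assumption; field.
Qed.

(** Halving the principal argument keeps it principal, so no multiple of
    [2 * PI] appears here. *)
Lemma Clog_Csqrt (x : R) : x <> 0%R -> Clog (Csqrt (RtoC x)) = Clog (RtoC x) / RtoC 2.
Proof.
  intros H; destruct (Rtotal_order x 0) as [Hx | [Hx | Hx]]; [| contradiction |].
  - rewrite Csqrt_neg, Clog_neg by exact Hx.
    pose proof (sqrt_lt_R0 (- x) ltac:(lra)) as Hs.
    unfold Clog, Carg.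
    rewrite Cmod_mult, Cmod_Ci, Cmod_R, Rabs_pos_eq, Rmult_1_l, ln_sqrt by lra.
    simpl; destruct (Rle_dec 0 (0 * 0 + 1 * sqrt (- x))) as [_ | n]; [| lra].
    replace ((0 * sqrt (- x) - 1 * 0) / sqrt (- x))%R with 0%R by (field; lra).
    rewrite acos_0; apply injective_projections; simpl; field.
  - rewrite Csqrt_pos, !Clog_pos by (try apply sqrt_lt_R0; exact Hx).
    rewrite ln_sqrt by exact Hx.
    apply injective_projections; simpl; field.
Qed.

Lemma Cexp_Clog_Csqrt (x : R) : x <> 0%R -> Cexp (Clog (Csqrt (RtoC x))) = Csqrt (RtoC x).
Proof.
  intros H; rewrite Clog_Csqrt by exact H.
  destruct (Rtotal_order x 0) as [Hx | [Hx | Hx]]; [| contradiction |].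
  - rewrite Csqrt_neg, Clog_neg by exact Hx.
    replace ((ln (- x), PI) / RtoC 2) with ((ln (sqrt (- x)), PI / 2) : C)%R.
    + unfold Cexp, Re, Im; simpl; rewrite cos_PI2, sin_PI2, exp_ln by (apply sqrt_lt_R0; lra).
      apply injective_projections; simpl; ring.
    + rewrite ln_sqrt by lra; apply injective_projections; simpl; field.
  - rewrite Csqrt_pos, Clog_pos by exact Hx.
    replace (RtoC (ln x) / RtoC 2) with (RtoC (ln (sqrt x))).
    + rewrite Cexp_RtoC, exp_ln by (apply sqrt_lt_R0; exact Hx); reflexivity.
    + rewrite ln_sqrt by exact Hx; apply injective_projections; simpl; field.
Qed.

Lemma Csqrt_mul_self (x : R) : x <> 0%R -> Csqrt (RtoC x) * Csqrt (RtoC x) = RtoC x.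
Proof.
  intros H; destruct (Rtotal_order x 0) as [Hx | [Hx | Hx]]; [| contradiction |].
  - rewrite Csqrt_neg by exact Hx.
    replace (RtoC x) with (Ci * Ci * RtoC (sqrt (- x) * sqrt (- x))).
    + rewrite RtoC_mult; ring.
    + rewrite sqrt_sqrt by lra; apply injective_projections; simpl; ring.
  - rewrite Csqrt_pos by exact Hx; rewrite <- RtoC_mult, sqrt_sqrt by lra; reflexivity.
Qed.

(** * Improper integrals over the positive half-line *)

Local Notation is_RInt_pos f :=
  (is_RInt_gen (V := C_R_NormedModule) f (at_right 0) (Rbar_locally p_infty)).

Lemma at_right_pos : at_right 0 (fun a => (0 < a)%R).
Proof. exists (mkposreal 1 Rlt_0_1); intros y _ Hy; exact Hy. Qed.

Lemma at_right_lt (d : R) : (0 < d)%R -> at_right 0 (fun a => (0 < a < d)%R).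
Proof.
  intros Hd; exists (mkposreal d Hd); intros y By Hy.
  unfold ball in By; simpl in By; unfold AbsRing_ball, abs, minus, plus, opp in By; simpl in By.
  rewrite Rabs_pos_eq in By; lra.
Qed.

Lemma p_infty_gt (A : R) : Rbar_locally p_infty (fun b => (A < b)%R).
Proof. exists A; auto. Qed.

Lemma filter_prod_pos (P : R -> R -> Prop) :
  (forall a b, (0 < a)%R -> (a < b)%R -> P a b) ->
  filter_prod (at_right 0) (Rbar_locally p_infty) (fun ab => P (fst ab) (snd ab)).
Proof.
  intros H.
  apply (Filter_prod _ _ _ _ _ (at_right_lt 1 Rlt_0_1) (p_infty_gt 1)).
  intros a b Ha Hb; apply H; simpl; lra.
Qed.

Lemma is_RInt_gen_primitive {V : NormedModule R_AbsRing} (f F : R -> V) (la lb : V) :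
  (forall a b, (0 < a)%R -> (a < b)%R -> is_RInt f a b (minus (F b) (F a))) ->
  filterlim F (at_right 0) (locally la) ->
  filterlim F (Rbar_locally p_infty) (locally lb) ->
  is_RInt_gen f (at_right 0) (Rbar_locally p_infty) (minus lb la).
Proof.
  intros HF Ha Hb.
  apply (filterlimi_lim_ext_loc (fun ab => minus (F (snd ab)) (F (fst ab)))).
  - apply (filter_prod_pos (fun a b => is_RInt f a b (minus (F b) (F a)))), HF.
  - unfold minus.
    apply (filterlim_comp_2 (F := filter_prod (at_right 0) (Rbar_locally p_infty))
             (G := locally lb) (H := locally (opp la))
             (fun ab => F (snd ab)) (fun ab => opp (F (fst ab))) plus).
    + apply filterlim_comp with (2 := Hb), filterlim_snd.
    + apply filterlim_comp with (2 := filterlim_opp la).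
      apply filterlim_comp with (2 := Ha), filterlim_fst.
    + apply filterlim_plus.
Qed.

Lemma is_RInt_pos_pair (f : R -> C) (l : C) :
  is_RInt_pos f l <->
  is_RInt_gen (fun t => Re (f t)) (at_right 0) (Rbar_locally p_infty) (Re l) /\
  is_RInt_gen (fun t => Im (f t)) (at_right 0) (Rbar_locally p_infty) (Im l).
Proof.
  split.
  - intros H; split.
    + apply (proj2 (filterlimi_locally (U := R_UniformSpace) _ _)); intros eps.
      apply filter_imp with (2 := proj1 (filterlimi_locally (U := C_UniformSpace) _ _) H eps).
      intros ab [z [Hz [B _]]]; exists (fst z); split; [| exact B].
      exact (is_RInt_fct_extend_fst (U := R_NormedModule) (V := R_NormedModule) f _ _ z Hz).
    + apply (proj2 (filterlimi_locally (U := R_UniformSpace) _ _)); intros eps.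
      apply filter_imp with (2 := proj1 (filterlimi_locally (U := C_UniformSpace) _ _) H eps).
      intros ab [z [Hz [_ B]]]; exists (snd z); split; [| exact B].
      exact (is_RInt_fct_extend_snd (U := R_NormedModule) (V := R_NormedModule) f _ _ z Hz).
  - intros [H1 H2].
    apply (proj2 (filterlimi_locally (U := C_UniformSpace) _ _)); intros eps.
    apply filter_imp with (2 := filter_and _ _
      (proj1 (filterlimi_locally (U := R_UniformSpace) _ _) H1 eps)
      (proj1 (filterlimi_locally (U := R_UniformSpace) _ _) H2 eps)).
    intros ab [[u [Hu Bu]] [v [Hv Bv]]]; exists (u, v); split; [| split; assumption].
    exact (is_RInt_fct_extend_pair (U := R_NormedModule) (V := R_NormedModule) f _ _ u v Hu Hv).
Qed.

Lemma is_RInt_pos_ext (f g : R -> C) (l : C) :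
  (forall t, (0 < t)%R -> f t = g t) -> is_RInt_pos f l -> is_RInt_pos g l.
Proof.
  intros H; apply is_RInt_gen_ext.
  apply (filter_prod_pos (fun a b => forall x, (Rmin a b < x < Rmax a b)%R -> f x = g x)).
  intros a b Ha Hab x Hx; apply H.
  rewrite Rmin_left in Hx; lra.
Qed.

Lemma is_RInt_pos_plus (f g : R -> C) (l m : C) :
  is_RInt_pos f l -> is_RInt_pos g m -> is_RInt_pos (fun t => f t + g t) (l + m).
Proof. exact (is_RInt_gen_plus (V := C_R_NormedModule) f g l m). Qed.

Lemma is_RInt_pos_minus (f g : R -> C) (l m : C) :
  is_RInt_pos f l -> is_RInt_pos g m -> is_RInt_pos (fun t => f t - g t) (l - m).
Proof. exact (is_RInt_gen_minus (V := C_R_NormedModule) f g l m). Qed.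

(** The integral is linear over the reals by definition; complex scalars act
    through the real and imaginary parts. *)
Lemma is_RInt_pos_Cmult (c : C) (f : R -> C) (l : C) :
  is_RInt_pos f l -> is_RInt_pos (fun t => c * f t) (c * l).
Proof.
  intros [H1 H2]%is_RInt_pos_pair; apply is_RInt_pos_pair; split.
  - exact (is_RInt_gen_minus (V := R_NormedModule) _ _ _ _
      (is_RInt_gen_scal (V := R_NormedModule) _ (Re c) _ H1)
      (is_RInt_gen_scal (V := R_NormedModule) _ (Im c) _ H2)).
  - exact (is_RInt_gen_plus (V := R_NormedModule) _ _ _ _
      (is_RInt_gen_scal (V := R_NormedModule) _ (Re c) _ H2)
      (is_RInt_gen_scal (V := R_NormedModule) _ (Im c) _ H1)).
Qed.

Lemma is_RInt_exp_half (M a b : R) :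
  is_RInt (fun t => M * exp (- t / 2))%R a b
    (- (2 * M) * exp (- b / 2) - - (2 * M) * exp (- a / 2))%R.
Proof.
  apply (is_RInt_derive (V := R_CompleteNormedModule)
           (fun t => - (2 * M) * exp (- t / 2))%R (fun t => M * exp (- t / 2))%R).
  - intros t _; auto_derive; [exact I | unfold Rdiv; field].
  - intros t _; apply (@ex_derive_continuous R_AbsRing R_NormedModule); auto_derive; exact I.
Qed.

Lemma filterlim_exp_half_0 (M : R) :
  filterlim (fun t => M * exp (- t / 2))%R (at_right 0) (locally M).
Proof.
  apply (filterlim_filter_le_1 (F := locally 0%R)); [intros P [e He]; exists e; auto |].
  assert (H : ex_derive (fun t => M * exp (- t / 2))%R 0%R) by (auto_derive; exact I).
  apply (@ex_derive_continuous R_AbsRing R_NormedModule) in H.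
  unfold continuous in H.
  replace (M * exp (- 0 / 2))%R with M in H
    by (replace (- 0 / 2)%R with 0%R by field; rewrite exp_0; ring).
  exact H.
Qed.

Lemma filterlim_exp_half_p_infty (M : R) :
  filterlim (fun t => M * exp (- t / 2))%R (Rbar_locally p_infty) (locally 0%R).
Proof.
  assert (H : is_lim (fun t => M * exp (- t / 2))%R p_infty (Rbar_mult M 0)).
  { apply is_lim_scal_l.
    apply is_lim_comp with m_infty.
    - apply is_lim_exp_m.
    - replace m_infty with (Rbar_mult (- / 2)%R p_infty).
      + apply is_lim_ext with (fun t => - / 2 * t)%R; [intros t; field |].
        apply is_lim_scal_l, is_lim_id.
      + simpl; destruct (Rle_dec 0 (- / 2)) as [h | h]; [exfalso; lra | reflexivity].
    - exists 0%R; intros t _; discriminate. }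
  simpl in H; rewrite Rmult_0_r in H; exact H.
Qed.

Lemma is_RInt_gen_exp_half (M : R) :
  is_RInt_gen (fun t => M * exp (- t / 2))%R (at_right 0) (Rbar_locally p_infty) (2 * M)%R.
Proof.
  replace (2 * M)%R with (0 - - (2 * M))%R by ring.
  apply (is_RInt_gen_primitive (V := R_NormedModule) (fun t => M * exp (- t / 2))%R
           (fun t => - (2 * M) * exp (- t / 2))%R).
  - intros a b _ _; apply is_RInt_exp_half.
  - apply filterlim_exp_half_0.
  - apply filterlim_exp_half_p_infty.
Qed.

Lemma Cmod_is_RInt_pos_le (f : R -> C) (l : C) (M : R) :
  (forall t, (0 < t)%R -> (Cmod (f t) <= M * exp (- t / 2))%R) ->
  is_RInt_pos f l -> (Cmod l <= 2 * M)%R.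
Proof.
  intros Hb Hf; rewrite <- Cmod_C_R_norm.
  apply (RInt_gen_norm (V := C_R_CompleteNormedModule) (Fa := at_right 0)
           (Fb := Rbar_locally p_infty) f (fun t => M * exp (- t / 2))%R l (2 * M)%R).
  - apply (filter_prod_pos (fun a b => (a <= b)%R)); intros; lra.
  - apply (filter_prod_pos (fun a b => forall x, (a <= x <= b)%R ->
             (norm (V := C_R_NormedModule) (f x) <= M * exp (- x / 2))%R)).
    intros a b Ha Hab x Hx; rewrite Cmod_C_R_norm; apply Hb; lra.
  - exact Hf.
  - apply is_RInt_gen_exp_half.
Qed.

Lemma Cmod_is_RInt_le_exp_half (f : R -> C) (a b M : R) (l : C) :
  (forall t, (0 < t)%R -> (Cmod (f t) <= M * exp (- t / 2))%R) ->
  (0 < a)%R -> (0 < b)%R -> is_RInt (V := C_R_NormedModule) f a b l ->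
  (Cmod l <= Rabs (2 * M * exp (- b / 2) - 2 * M * exp (- a / 2)))%R.
Proof.
  intros Hf.
  assert (K : forall a b l, (0 < a)%R -> (a <= b)%R ->
    is_RInt (V := C_R_NormedModule) f a b l ->
    (Cmod l <= Rabs (2 * M * exp (- b / 2) - 2 * M * exp (- a / 2)))%R).
  { clear a b l; intros a b l Ha Hab H.
    rewrite <- Cmod_C_R_norm.
    apply Rle_trans with (- (2 * M) * exp (- b / 2) - - (2 * M) * exp (- a / 2))%R.
    - refine (norm_RInt_le (V := C_R_NormedModule) f _ a b l _ Hab _ H (is_RInt_exp_half M a b)).
      intros t Ht; rewrite Cmod_C_R_norm; apply Hf; lra.
    - rewrite <- Rabs_Ropp.
      apply Rle_trans with (2 := Rle_abs _); right; ring. }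
  intros Ha Hb H; destruct (Rle_or_lt a b) as [L | L].
  - apply K; assumption.
  - rewrite <- (Cmod_opp l), Rabs_minus_sym.
    apply K; [exact Hb | lra |].
    exact (is_RInt_swap (V := C_R_NormedModule) f b a l H).
Qed.

(** Cauchy criterion: moving an endpoint from [a] to [a'] changes the integral by at
    most the variation of the primitive [- 2 M exp (- t / 2)] of the bound, and
    that primitive converges at both ends. *)
Lemma ex_RInt_pos_dominated (f : R -> C) (M : R) :
  (forall t, (0 < t)%R -> continuous (T := R_UniformSpace) (U := C_UniformSpace) f t) ->
  (forall t, (0 < t)%R -> (Cmod (f t) <= M * exp (- t / 2))%R) ->
  exists l, is_RInt_pos f l.
Proof.
  intros Hc Hf.
  apply (filterlimi_locally_cauchy (U := C_R_CompleteNormedModule)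
           (fun ab => is_RInt (V := C_R_NormedModule) f (fst ab) (snd ab))).
  - apply (filter_prod_pos (fun a b =>
      (exists y, is_RInt (V := C_R_NormedModule) f a b y) /\
      (forall y1 y2, is_RInt (V := C_R_NormedModule) f a b y1 ->
                     is_RInt (V := C_R_NormedModule) f a b y2 -> y1 = y2))).
    intros a b Ha Hab; split.
    + apply (ex_RInt_continuous (V := C_R_CompleteNormedModule)).
      intros z Hz; apply Hc; rewrite Rmin_left in Hz; lra.
    + intros y1 y2 H1 H2.
      rewrite <- (is_RInt_unique (V := C_R_CompleteNormedModule) f a b y1 H1).
      exact (is_RInt_unique (V := C_R_CompleteNormedModule) f a b y2 H2).
  - intros eps.
    assert (He : (0 < eps / 4)%R) by (pose proof (cond_pos eps); lra).
    pose proof (proj1 (filterlim_locally _ _) (filterlim_exp_half_0 (2 * M))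
                  (mkposreal _ He)) as K0.
    pose proof (proj1 (filterlim_locally _ _) (filterlim_exp_half_p_infty (2 * M))
                  (mkposreal _ He)) as K1.
    pose (G := fun t => (2 * M * exp (- t / 2))%R).
    exists (fun ab => ((0 < fst ab /\ Rabs (G (fst ab) - 2 * M) < eps / 4) /\
                       (0 < snd ab /\ Rabs (G (snd ab) - 0) < eps / 4))%R).
    split.
    { refine (Filter_prod _ _ _ _ _ (filter_and _ _ at_right_pos K0)
                (filter_and _ _ (p_infty_gt 0) K1) _).
      intros a b [A1 A2] [B1 B2]; repeat split; assumption. }
    intros [a b] [a' b'] [[Ha Ka] [Hb Kb]] [[Ha' Ka'] [Hb' Kb']] u v Hu Hv; simpl in *.
    assert (Hex : forall x y, (0 < x)%R -> (0 < y)%R ->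
              exists z, is_RInt (V := C_R_NormedModule) f x y z).
    { intros x y Hx Hy; apply (ex_RInt_continuous (V := C_R_CompleteNormedModule)).
      intros z Hz; apply Hc.
      pose proof (Rmin_glb_lt x y 0 Hx Hy); lra. }
    destruct (Hex a' a Ha' Ha) as [p Hp].
    destruct (Hex b b' Hb Hb') as [q Hq].
    assert (E : v = p + u + q).
    { rewrite <- (is_RInt_unique (V := C_R_CompleteNormedModule) f a' b' v Hv).
      apply (is_RInt_unique (V := C_R_CompleteNormedModule)).
      apply (is_RInt_Chasles (V := C_R_NormedModule)) with b; [| exact Hq].
      apply (is_RInt_Chasles (V := C_R_NormedModule)) with a; assumption. }
    apply (norm_compat1 (V := C_R_NormedModule)); rewrite Cmod_C_R_norm.
    change (Cmod (v - u) < eps)%R.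
    replace (v - u) with (p + q) by (rewrite E; ring).
    apply Rle_lt_trans with (1 := Cmod_triangle p q).
    pose proof (Cmod_is_RInt_le_exp_half f a' a M p Hf Ha' Ha Hp) as Bp.
    pose proof (Cmod_is_RInt_le_exp_half f b b' M q Hf Hb Hb' Hq) as Bq.
    fold (G a) (G a') in Bp; fold (G b) (G b') in Bq.
    pose proof (Rabs_triang (G a - 2 * M) (- (G a' - 2 * M))) as T1.
    pose proof (Rabs_triang (G b' - 0) (- (G b - 0))) as T2.
    rewrite Rabs_Ropp in T1, T2.
    replace (G a - 2 * M + - (G a' - 2 * M))%R with (G a - G a')%R in T1 by ring.
    replace (G b' - 0 + - (G b - 0))%R with (G b' - G b)%R in T2 by ring.
    lra.
Qed.

(** * The Gamma integral *)

(** For [0 < t] this is [t ^ w * exp (- t)], in a form that differentiates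
    well both in [t] and in [w]. *)
Definition Gamma_kernel (w : C) (t : R) : C := Cexp (w * RtoC (ln t) - RtoC t).

Lemma Cmod_Gamma_kernel (w : C) (t : R) :
  Cmod (Gamma_kernel w t) = exp (Re w * ln t - t).
Proof.
  unfold Gamma_kernel; rewrite Cmod_Cexp; f_equal; destruct w as [a b]; simpl; ring.
Qed.

Lemma Gamma_kernel_plus (w h : C) (t : R) :
  Gamma_kernel (w + h) t = Gamma_kernel w t * Cexp (h * RtoC (ln t)).
Proof. unfold Gamma_kernel; rewrite <- Cexp_plus; f_equal; ring. Qed.

Lemma continuous_Gamma_kernel (w : C) (t : R) :
  (0 < t)%R -> continuous (T := R_UniformSpace) (U := C_UniformSpace) (Gamma_kernel w) t.
Proof.
  intros Ht; destruct w as [a b]; unfold Gamma_kernel, Cexp.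
  apply continuous_C; simpl;
    apply (@ex_derive_continuous R_AbsRing R_NormedModule); auto_derive; repeat split; auto.
Qed.

Lemma continuous_ln_Gamma_kernel (w : C) (t : R) :
  (0 < t)%R -> continuous (T := R_UniformSpace) (U := C_UniformSpace)
    (fun u => RtoC (ln u) * Gamma_kernel w u) t.
Proof.
  intros Ht; destruct w as [a b]; unfold Gamma_kernel, Cexp.
  apply continuous_C; simpl;
    apply (@ex_derive_continuous R_AbsRing R_NormedModule); auto_derive; repeat split; auto.
Qed.

(** Multiply [ln (t / (2 s)) <= t / (2 s)] by [s]: a power of [t] costs only half of
    the exponential decay. *)
Lemma exp_ln_minus_le (s t : R) :
  (0 < s)%R -> (0 < t)%R ->
  (exp (s * ln t - t) <= exp (s * ln (2 * s)) * exp (- t / 2))%R.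
Proof.
  intros Hs Ht; rewrite <- exp_plus; apply exp_le.
  assert (H : (ln (t / (2 * s)) <= t / (2 * s))%R).
  { assert (Hp : (0 < t / (2 * s))%R) by (apply Rdiv_lt_0_compat; lra).
    pose proof (exp_ineq1_le (ln (t / (2 * s)))) as E; rewrite exp_ln in E by exact Hp; lra. }
  unfold Rdiv in H; rewrite ln_mult, ln_Rinv in H by (try apply Rinv_0_lt_compat; lra).
  apply Rmult_le_compat_l with (r := s) in H; [| lra].
  replace (s * (t * / (2 * s)))%R with (t / 2)%R in H by (field; lra); lra.
Qed.

(** The logarithmic factors produced by differentiating in the exponent are
    absorbed by a small power of [t] or of [1 / t]. *)
Lemma log_weight_bound (s : R) :
  (0 < s)%R -> exists M, (0 <= M)%R /\ forall t r, (0 < t)%R -> (0 <= r <= s / 4)%R ->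
    ((Rabs (ln t) + Rabs (ln t) ^ 2) * exp (r * Rabs (ln t)) * exp (s * ln t - t)
      <= M * exp (- t / 2))%R.
Proof.
  intros Hs; pose (d := (s / 4)%R); assert (Hd : (0 < d)%R) by (unfold d; lra).
  pose (k := fun p => exp (p * ln (2 * p))).
  (* [u <= exp (d u) / d] and [u ^ 2 <= 4 exp (d u) / d ^ 2] absorb the logarithms,
     and [exp (2 d |ln t|)] is at most [t ^ (2 d) + t ^ (- 2 d)] *)
  exists ((/ d + 4 * / d ^ 2) * (k (s + 2 * d) + k (s - 2 * d)))%R; split.
  { apply Rmult_le_pos.
    - apply Rplus_le_le_0_compat; [left; apply Rinv_0_lt_compat, Hd |].
      apply Rmult_le_pos; [lra | left; apply Rinv_0_lt_compat, pow_lt, Hd].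
    - unfold k; pose proof (exp_pos ((s + 2 * d) * ln (2 * (s + 2 * d))));
        pose proof (exp_pos ((s - 2 * d) * ln (2 * (s - 2 * d)))); lra. }
  intros t r Ht Hr; set (u := Rabs (ln t)).
  assert (Hu : (0 <= u)%R) by apply Rabs_pos.
  assert (P : (u + u ^ 2 <= (/ d + 4 * / d ^ 2) * exp (d * u))%R).
  { assert (P1 : (d * u <= exp (d * u))%R) by (pose proof (exp_ineq1_le (d * u)); lra).
    assert (P2 : ((d * u) ^ 2 <= 4 * exp (d * u))%R).
    { replace (d * u)%R with (d * u / 2 + d * u / 2)%R at 2 by field.
      rewrite exp_plus.
      pose proof (exp_ineq1_le (d * u / 2)).
      assert (0 <= d * u)%R by (apply Rmult_le_pos; lra).
      nra. }
    rewrite Rmult_plus_distr_r; apply Rplus_le_compat.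
    - apply Rmult_le_reg_l with d; [exact Hd |].
      rewrite <- Rmult_assoc, Rinv_r by lra; lra.
    - apply Rmult_le_reg_l with (d ^ 2)%R; [apply pow_lt, Hd |].
      replace (d ^ 2 * (4 * / d ^ 2 * exp (d * u)))%R with (4 * exp (d * u))%R
        by (field; lra).
      rewrite <- Rpow_mult_distr; exact P2. }
  assert (Q : (exp (d * u) * exp (r * u) * exp (s * ln t - t)
               <= (k (s + 2 * d) + k (s - 2 * d)) * exp (- t / 2))%R).
  { rewrite <- !exp_plus.
    pose proof (exp_ln_minus_le (s + 2 * d) t ltac:(lra) Ht) as Q1.
    pose proof (exp_ln_minus_le (s - 2 * d) t ltac:(unfold d; lra) Ht) as Q2.
    fold (k (s + 2 * d)%R) in Q1; fold (k (s - 2 * d)%R) in Q2.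
    assert (R : (r * u <= d * u)%R) by (apply Rmult_le_compat_r; [exact Hu | apply Hr]).
    rewrite Rmult_plus_distr_r.
    destruct (Rle_or_lt 0 (ln t)) as [L | L].
    - apply Rle_trans with (exp ((s + 2 * d) * ln t - t)).
      + apply exp_le; unfold u in *; rewrite Rabs_pos_eq in * by exact L; lra.
      + pose proof (exp_pos ((s - 2 * d) * ln t - t)); lra.
    - apply Rle_trans with (exp ((s - 2 * d) * ln t - t)).
      + apply exp_le; unfold u in *; rewrite Rabs_left in * by exact L; lra.
      + pose proof (exp_pos ((s + 2 * d) * ln t - t)); lra. }
  apply Rle_trans with ((/ d + 4 * / d ^ 2) * exp (d * u) * exp (r * u) * exp (s * ln t - t))%R.
  - apply Rmult_le_compat_r; [left; apply exp_pos |].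
    apply Rmult_le_compat_r; [left; apply exp_pos | exact P].
  - rewrite !Rmult_assoc; rewrite !Rmult_assoc in Q.
    apply Rmult_le_compat_l; [| exact Q].
    apply Rplus_le_le_0_compat; [left; apply Rinv_0_lt_compat, Hd |].
    apply Rmult_le_pos; [lra | left; apply Rinv_0_lt_compat, pow_lt, Hd].
Qed.

Lemma Gamma_integrand_kernel (w : C) (t : R) :
  (0 < t)%R -> Cpower (RtoC t) w * RtoC (exp (- t)) = Gamma_kernel w t.
Proof.
  intros Ht; unfold Cpower, Gamma_kernel.
  rewrite Clog_pos, <- Cexp_RtoC, <- Cexp_plus by exact Ht.
  f_equal; rewrite RtoC_opp; reflexivity.
Qed.

Lemma Gamma_integral_eq (s l : C) :
  is_RInt_pos (Gamma_kernel (s - RtoC 1)) l -> Gamma_integral s = l.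
Proof.
  intros H; unfold Gamma_integral.
  apply (is_RInt_gen_unique (V := C_R_CompleteNormedModule) (Fa := at_right 0)
           (Fb := Rbar_locally p_infty)).
  apply is_RInt_pos_ext with (2 := H).
  intros t Ht; symmetry; apply Gamma_integrand_kernel, Ht.
Qed.

Lemma is_RInt_pos_Gamma_kernel_gt_1 (s : C) :
  (1 < Re s)%R -> is_RInt_pos (Gamma_kernel (s - RtoC 1)) (Gamma_integral s).
Proof.
  intros Hs.
  assert (Hp : (0 < Re (s - RtoC 1))%R) by (destruct s; simpl in *; lra).
  destruct (ex_RInt_pos_dominated (Gamma_kernel (s - RtoC 1))
              (exp (Re (s - RtoC 1) * ln (2 * Re (s - RtoC 1))))) as [l Hl].
  - intros t Ht; apply continuous_Gamma_kernel, Ht.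
  - intros t Ht; rewrite Cmod_Gamma_kernel; apply exp_ln_minus_le; assumption.
  - rewrite (Gamma_integral_eq s l Hl); exact Hl.
Qed.

Lemma filterlim_Gamma_kernel_0 (w : C) :
  (0 < Re w)%R ->
  filterlim (Gamma_kernel w) (at_right 0) (locally (T := C_UniformSpace) (RtoC 0)).
Proof.
  intros Hw.
  apply (filterlim_locally_ball_norm (U := C_NormedModule)); intros eps.
  pose proof (cond_pos eps) as He.
  apply filter_imp with (2 := at_right_lt (exp (ln eps / Re w)) (exp_pos _)).
  intros t [Ht0 Ht1].
  change (Cmod (Gamma_kernel w t - RtoC 0) < eps)%R.
  replace (Gamma_kernel w t - RtoC 0) with (Gamma_kernel w t) by ring.
  rewrite Cmod_Gamma_kernel.
  rewrite <- (exp_ln eps He); apply exp_increasing.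
  apply ln_increasing in Ht1; [| exact Ht0]; rewrite ln_exp in Ht1.
  apply Rmult_lt_compat_l with (1 := Hw) in Ht1.
  replace (Re w * (ln eps / Re w))%R with (ln eps) in Ht1 by (field; lra); lra.
Qed.

Lemma filterlim_Gamma_kernel_p_infty (w : C) :
  (0 < Re w)%R ->
  filterlim (Gamma_kernel w) (Rbar_locally p_infty) (locally (T := C_UniformSpace) (RtoC 0)).
Proof.
  intros Hw.
  apply (filterlim_locally_ball_norm (U := C_NormedModule)); intros eps.
  pose proof (filterlim_exp_half_p_infty (exp (Re w * ln (2 * Re w)))) as H.
  apply filter_imp with (2 := filter_and _ _ (p_infty_gt 0)
                                (proj1 (filterlim_locally _ _) H eps)).
  intros t [Ht B].
  change (Cmod (Gamma_kernel w t - RtoC 0) < eps)%R.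
  replace (Gamma_kernel w t - RtoC 0) with (Gamma_kernel w t) by ring.
  rewrite Cmod_Gamma_kernel.
  apply Rle_lt_trans with (1 := exp_ln_minus_le (Re w) t Hw Ht).
  unfold ball in B; simpl in B; unfold AbsRing_ball, abs, minus, plus, opp in B; simpl in B.
  apply Rle_lt_trans with (2 := B).
  apply Rle_trans with (2 := Rle_abs _); lra.
Qed.

Lemma is_RInt_Gamma_kernel_derive (w : C) (a b : R) :
  (0 < a)%R -> (a < b)%R ->
  is_RInt (V := C_R_NormedModule)
    (fun t => w * Gamma_kernel (w - RtoC 1) t - Gamma_kernel w t) a b
    (Gamma_kernel w b - Gamma_kernel w a).
Proof.
  intros Ha Hab.
  apply is_RInt_C_derive; intros t Ht.
  rewrite Rmin_left in Ht by lra.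
  assert (Ht0 : (0 < t)%R) by lra.
  assert (E : w * Gamma_kernel (w - RtoC 1) t - Gamma_kernel w t
              = (w * RtoC (/ t) - RtoC 1) * Gamma_kernel w t).
  { replace (w - RtoC 1) with (w + RtoC (- (1))) by (rewrite RtoC_opp; ring).
    rewrite Gamma_kernel_plus.
    replace (Cexp (RtoC (- (1)) * RtoC (ln t))) with (RtoC (/ t)); [ring |].
    rewrite <- RtoC_mult, Cexp_RtoC; f_equal.
    replace (- (1) * ln t)%R with (- ln t)%R by ring.
    rewrite exp_Ropp, exp_ln by exact Ht0; reflexivity. }
  rewrite E; clear E.
  split; [| split].
  - destruct w as [p q]; unfold Gamma_kernel, Cexp, Re, Im; simpl.
    auto_derive; [repeat split; auto |]; unfold Rminus; field; lra.
  - destruct w as [p q]; unfold Gamma_kernel, Cexp, Re, Im; simpl.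
    auto_derive; [repeat split; auto |]; unfold Rminus; field; lra.
  - destruct w as [p q]; unfold Gamma_kernel, Cexp, Re, Im; simpl.
    split; apply (@ex_derive_continuous R_AbsRing R_NormedModule); auto_derive; repeat split; auto.
Qed.

(** Integration by parts: the kernel of exponent [s] vanishes at both ends. *)
Lemma Gamma_by_parts (s : C) :
  (0 < Re s)%R ->
  is_RInt_pos (fun t => s * Gamma_kernel (s - RtoC 1) t) (Gamma_integral (s + RtoC 1)).
Proof.
  intros Hs.
  assert (H1 : is_RInt_pos (fun t => s * Gamma_kernel (s - RtoC 1) t - Gamma_kernel s t)
                 (RtoC 0 - RtoC 0)).
  { apply (is_RInt_gen_primitive (V := C_R_NormedModule) _ (Gamma_kernel s)).
    - intros a b; apply is_RInt_Gamma_kernel_derive.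
    - apply filterlim_Gamma_kernel_0, Hs.
    - apply filterlim_Gamma_kernel_p_infty, Hs. }
  assert (H2 : is_RInt_pos (Gamma_kernel s) (Gamma_integral (s + RtoC 1))).
  { replace s with (s + RtoC 1 - RtoC 1) at 1 by ring.
    apply is_RInt_pos_Gamma_kernel_gt_1; destruct s; simpl in *; lra. }
  replace (Gamma_integral (s + RtoC 1))
    with (RtoC 0 - RtoC 0 + Gamma_integral (s + RtoC 1)) by ring.
  apply is_RInt_pos_ext with (2 := is_RInt_pos_plus _ _ _ _ H1 H2).
  intros t _; ring.
Qed.

Lemma Gamma_integral_succ (s : C) :
  (0 < Re s)%R -> Gamma_integral (s + RtoC 1) = s * Gamma_integral s.
Proof.
  intros Hs.
  assert (Hs0 : s <> RtoC 0) by (intros ->; simpl in Hs; lra).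
  rewrite (Gamma_integral_eq s (/ s * Gamma_integral (s + RtoC 1))).
  - field; exact Hs0.
  - apply is_RInt_pos_ext with (2 := is_RInt_pos_Cmult (/ s) _ _ (Gamma_by_parts s Hs)).
    intros t _; field; exact Hs0.
Qed.

Lemma Gamma_integral_1 : Gamma_integral (RtoC 1) = RtoC 1.
Proof.
  apply Gamma_integral_eq.
  enough (K : is_RInt_pos (Gamma_kernel (RtoC 1 - RtoC 1)) (RtoC 0 - - RtoC 1))
    by (replace (RtoC 0 - - RtoC 1) with (RtoC 1) in K by ring; exact K).
  assert (E : forall t, Gamma_kernel (RtoC 0) t = RtoC (exp (- t))).
  { intros t; unfold Gamma_kernel; rewrite <- Cexp_RtoC, RtoC_opp; f_equal; ring. }
  apply (is_RInt_gen_primitive (V := C_R_NormedModule) _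
           (fun t => - Gamma_kernel (RtoC 0) t)).
  - intros a b Ha Hab.
    assert (H : is_RInt (V := C_R_NormedModule)
                  (fun t => - (RtoC 0 * Gamma_kernel (RtoC 0 - RtoC 1) t - Gamma_kernel (RtoC 0) t))
                  a b (- (Gamma_kernel (RtoC 0) b - Gamma_kernel (RtoC 0) a)))
      by exact (is_RInt_opp (V := C_R_NormedModule) _ a b _
                  (is_RInt_Gamma_kernel_derive (RtoC 0) a b Ha Hab)).
    replace (- (Gamma_kernel (RtoC 0) b - Gamma_kernel (RtoC 0) a))
      with (- Gamma_kernel (RtoC 0) b - - Gamma_kernel (RtoC 0) a) in H by ring.
    apply (is_RInt_ext (V := C_R_NormedModule)) with (2 := H).
    intros t _.
    replace (RtoC 1 - RtoC 1) with (RtoC 0) by ring.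
    change (- (RtoC 0 * Gamma_kernel (RtoC 0 - RtoC 1) t - Gamma_kernel (RtoC 0) t)
            = Gamma_kernel (RtoC 0) t); ring.
  - apply (filterlim_locally_ball_norm (U := C_NormedModule)); intros eps.
    apply filter_imp with (2 := at_right_lt eps (cond_pos eps)).
    intros t [Ht0 Ht1].
    change (Cmod (- Gamma_kernel (RtoC 0) t - - RtoC 1) < eps)%R.
    rewrite E; replace (- RtoC (exp (- t)) - - RtoC 1) with (RtoC (1 - exp (- t)))
      by (rewrite RtoC_minus; ring).
    pose proof (exp_ineq1_le (- t)) as E1.
    pose proof (exp_le (- t) 0 ltac:(lra)) as E2; rewrite exp_0 in E2.
    rewrite Cmod_R, Rabs_pos_eq; lra.
  - apply (filterlim_locally_ball_norm (U := C_NormedModule)); intros eps.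
    apply filter_imp with (2 := filter_and _ _ (p_infty_gt (- ln eps)) (p_infty_gt 0)).
    intros t [Ht1 Ht0].
    change (Cmod (- Gamma_kernel (RtoC 0) t - RtoC 0) < eps)%R.
    rewrite E; replace (- RtoC (exp (- t)) - RtoC 0) with (- RtoC (exp (- t))) by ring.
    rewrite Cmod_opp, Cmod_R, Rabs_pos_eq by (left; apply exp_pos).
    rewrite <- (exp_ln eps (cond_pos eps)) at 1; apply exp_increasing; lra.
Qed.

Lemma Gamma_integral_nat_neq_0 (n : nat) : Gamma_integral (RtoC (INR (S n))) <> RtoC 0.
Proof.
  induction n as [| n IH].
  - simpl; rewrite Gamma_integral_1; intros H%RtoC_inj; lra.
  - rewrite S_INR, RtoC_plus, Gamma_integral_succ.
    + apply Cmult_neq_0; [| exact IH].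
      intros H%RtoC_inj; pose proof (pos_INR n); rewrite S_INR in H; lra.
    + change (0 < INR (S n))%R; pose proof (pos_INR n); rewrite S_INR; lra.
Qed.

(** The derivative is the integral of the kernel times [ln t]: the Taylor remainder
    of the kernel in the exponent is quadratic in the increment, uniformly in [t]
    up to an integrable weight, so differentiation passes under the integral. *)
Lemma is_Cderive_Gamma_integral (s : C) :
  (1 < Re s)%R -> exists l, is_Cderive Gamma_integral s l.
Proof.
  intros Hs.
  pose (w := s - RtoC 1).
  assert (Hw : (0 < Re w)%R) by (unfold w; destruct s; simpl in *; lra).
  destruct (log_weight_bound (Re w) Hw) as [M [HM B]].
  destruct (ex_RInt_pos_dominated (fun t => RtoC (ln t) * Gamma_kernel w t) M) as [l Hl].
  - intros t Ht; apply continuous_ln_Gamma_kernel, Ht.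
  - intros t Ht; rewrite Cmod_mult, Cmod_R, Cmod_Gamma_kernel.
    apply Rle_trans with (2 := B t 0%R Ht ltac:(lra)).
    rewrite Rmult_0_l, exp_0, Rmult_1_r.
    apply Rmult_le_compat_r; [left; apply exp_pos |].
    pose proof (pow2_ge_0 (Rabs (ln t))); lra.
  - exists l.
    apply is_Cderive_quadratic with (Re w / 4)%R (2 * M)%R; [lra |].
    intros y Hy; set (h := y - s) in *.
    assert (Hy1 : (1 < Re y)%R).
    { pose proof (re_le_Cmod h) as A; apply Rabs_le_between in A.
      assert (Re y = Re h + Re w + 1)%R
        by (unfold h, w; destruct y, s; simpl; ring).
      lra. }
    replace (2 * M * Cmod h ^ 2)%R with (2 * (Cmod h ^ 2 * M))%R by ring.
    apply Cmod_is_RInt_pos_le with (fun t =>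
      (Gamma_kernel (y - RtoC 1) t - Gamma_kernel w t)
      - h * (RtoC (ln t) * Gamma_kernel w t)).
    + intros t Ht.
      replace (y - RtoC 1) with (w + h) by (unfold w, h; ring).
      rewrite Gamma_kernel_plus.
      replace (Gamma_kernel w t * Cexp (h * RtoC (ln t)) - Gamma_kernel w t
               - h * (RtoC (ln t) * Gamma_kernel w t))
        with ((Cexp (h * RtoC (ln t)) - RtoC 1 - h * RtoC (ln t)) * Gamma_kernel w t) by ring.
      rewrite Cmod_mult, Cmod_Gamma_kernel.
      apply Rle_trans with (Cmod h ^ 2 *
        ((Rabs (ln t) + Rabs (ln t) ^ 2) * exp (Cmod h * Rabs (ln t))
          * exp (Re w * ln t - t)))%R.
      * rewrite <- Rmult_assoc; apply Rmult_le_compat_r; [left; apply exp_pos |].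
        apply Rle_trans with (1 := Cexp_minus_1_minus_bound _).
        rewrite Cmod_mult, Cmod_R, Rpow_mult_distr, <- Rmult_assoc.
        apply Rmult_le_compat_r; [left; apply exp_pos |].
        apply Rmult_le_compat_l; [apply pow2_ge_0 | pose proof (Rabs_pos (ln t)); lra].
      * rewrite (Rmult_assoc (Cmod h ^ 2) M).
        apply Rmult_le_compat_l; [apply pow2_ge_0 |].
        apply B; [exact Ht |]; split; [apply Cmod_ge_0 | lra].
    + apply is_RInt_pos_minus; [apply is_RInt_pos_minus |].
      * apply is_RInt_pos_Gamma_kernel_gt_1, Hy1.
      * apply is_RInt_pos_Gamma_kernel_gt_1, Hs.
      * apply is_RInt_pos_Cmult, Hl.
Qed.

(** * The reciprocal Gamma function *)

Lemma Cpochhammer_shift (z : C) (n : nat) :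
  Cpochhammer z (S n) = z * Cpochhammer (z + RtoC 1) n.
Proof.
  induction n as [| n IH].
  - simpl; ring.
  - change (Cpochhammer z (S (S n))) with (Cpochhammer z (S n) * (z + RtoC (INR (S n)))).
    rewrite IH, S_INR, RtoC_plus; simpl; ring.
Qed.

Lemma up_neg_le_0 (x : R) : (0 < x)%R -> (up (- x) <= 0)%Z.
Proof.
  intros Hx; destruct (archimed (- x)) as [_ H].
  assert (IZR (up (- x)) < 1)%R by lra.
  apply lt_IZR in H0; lia.
Qed.

Lemma rGamma_pos (s : C) : (0 < Re s)%R -> rGamma s = / Gamma_integral s.
Proof.
  intros Hs; unfold rGamma.
  replace (Z.to_nat (up (- Re s))) with 0%nat
    by (pose proof (up_neg_le_0 (Re s) Hs); lia); simpl.
  rewrite Cplus_0_r; unfold Cdiv; ring.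
Qed.

Lemma Cinv_0 : / RtoC 0 = RtoC 0.
Proof.
  unfold Cinv, RtoC; simpl; unfold Rdiv; f_equal; ring.
Qed.

Lemma Cinv_mult (a b : C) : / (a * b) = / a * / b.
Proof.
  destruct (Ceq_dec a (RtoC 0)) as [-> | Ha].
  - rewrite Cmult_0_l, Cinv_0; ring.
  - destruct (Ceq_dec b (RtoC 0)) as [-> | Hb].
    + rewrite Cmult_0_r, Cinv_0; ring.
    + field; auto.
Qed.

(** For [0 < Re s] this inverts the recurrence of the integral, both sides being 0
    if [Gamma_integral s] is 0; for [Re s <= 0] both sides involve the same value
    of the integral. *)
Lemma rGamma_succ (s : C) : rGamma s = s * rGamma (s + RtoC 1).
Proof.
  destruct (Rlt_or_le 0 (Re s)) as [Hs | Hs].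
  - rewrite !rGamma_pos by (destruct s; simpl in *; lra).
    rewrite Gamma_integral_succ, Cinv_mult by exact Hs.
    rewrite Cmult_assoc, Cinv_r; [ring |].
    intros ->; simpl in Hs; lra.
  - (* the shift for [s + 1] is one less than the shift for [s] *)
    assert (U : up (- Re s) = (up (- Re (s + RtoC 1)) + 1)%Z).
    { symmetry; apply tech_up; rewrite plus_IZR;
        destruct (archimed (- Re (s + RtoC 1))); destruct s; simpl in *; lra. }
    assert (U0 : (0 <= up (- Re (s + RtoC 1)))%Z).
    { destruct (archimed (- Re s)) as [A _].
      assert (0 < up (- Re s))%Z by (apply lt_IZR; lra).
      lia. }
    unfold rGamma; rewrite U, Z2Nat.inj_add by lia.
    change (Z.to_nat 1) with 1%nat; rewrite Nat.add_1_r.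
    rewrite Cpochhammer_shift, S_INR, RtoC_plus.
    set (n := Z.to_nat (up (- Re (s + RtoC 1)))).
    replace (s + (RtoC (INR n) + RtoC 1)) with (s + RtoC 1 + RtoC (INR n)) by ring.
    unfold Cdiv; ring.
Qed.

Lemma is_Cderive_rGamma_nat (n : nat) :
  exists l, is_Cderive rGamma (RtoC (INR (S (S n)))) l.
Proof.
  set (a := RtoC (INR (S (S n)))).
  assert (Ha : (2 <= Re a)%R).
  { unfold a; rewrite !S_INR; simpl; pose proof (pos_INR n); lra. }
  destruct (is_Cderive_Gamma_integral a ltac:(lra)) as [l Hl].
  eexists; apply is_Cderive_ext_loc with (fun z => / Gamma_integral z) 1%R; [lra | |].
  - intros y Hy; symmetry; apply rGamma_pos.
    pose proof (re_le_Cmod (y - a)) as A; apply Rabs_le_between in A.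
    assert (Re y = Re (y - a) + Re a)%R by (destruct y, a; simpl; ring); lra.
  - apply is_Cderive_inv; [exact Hl | apply Gamma_integral_nat_neq_0].
Qed.

(** * Complex series *)

Local Notation is_Cseries := (@is_series C_AbsRing C_NormedModule).

Lemma Cseries_eq (a : nat -> C) (l : C) : is_Cseries a l -> Cseries a = l.
Proof.
  exact (iota_filterlim_locally (V := C_CompleteNormedModule) (F := eventually)
           (sum_n (G := C_NormedModule) a) l).
Qed.

Lemma is_Cseries_Cseries (a : nat -> C) :
  (exists l, is_Cseries a l) -> is_Cseries a (Cseries a).
Proof. intros [l Hl]; rewrite (Cseries_eq a l Hl); exact Hl. Qed.

Lemma Cseries_ext (a b : nat -> C) : (forall k, a k = b k) -> Cseries a = Cseries b.
Proof.
  intros H; apply (eq_close (V := C_NormedModule)).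
  apply (close_iota (T := C_CompleteNormedModule)); intros l.
  split; apply is_series_ext; intros k; [| symmetry]; apply H.
Qed.

Lemma is_Cseries_ext (a b : nat -> C) (l : C) :
  (forall k, a k = b k) -> is_Cseries a l -> is_Cseries b l.
Proof. exact (is_series_ext (V := C_NormedModule) a b l). Qed.

Lemma is_Cseries_plus (a b : nat -> C) (l m : C) :
  is_Cseries a l -> is_Cseries b m -> is_Cseries (fun k => a k + b k) (l + m).
Proof. exact (is_series_plus (V := C_NormedModule) a b l m). Qed.

Lemma is_Cseries_minus (a b : nat -> C) (l m : C) :
  is_Cseries a l -> is_Cseries b m -> is_Cseries (fun k => a k - b k) (l - m).
Proof. exact (is_series_minus (V := C_NormedModule) a b l m). Qed.

Lemma is_Cseries_scal (c : C) (a : nat -> C) (l : C) :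
  is_Cseries a l -> is_Cseries (fun k => c * a k) (c * l).
Proof. exact (is_series_scal (V := C_NormedModule) c a l). Qed.

Lemma ex_Cseries_le (a : nat -> C) (b : nat -> R) :
  (forall k, (Cmod (a k) <= b k)%R) -> ex_series b -> exists l, is_Cseries a l.
Proof. exact (ex_series_le (V := C_CompleteNormedModule) a b). Qed.

Lemma Cmod_Cseries_le (a : nat -> C) (b : nat -> R) (l : C) (m : R) :
  (forall k, (Cmod (a k) <= b k)%R) -> is_Cseries a l -> is_series b m -> (Cmod l <= m)%R.
Proof.
  intros H Ha Hb.
  change (Rbar_le (Cmod l) m).
  apply is_lim_seq_le with (fun n => Cmod (sum_n (G := C_NormedModule) a n)) (sum_n b).
  - intros n; induction n as [| n IH].
    + rewrite !sum_O; apply H.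
    + rewrite !sum_Sn; apply Rle_trans with (1 := Cmod_triangle _ _).
      apply Rplus_le_compat; [exact IH | apply H].
  - exact (filterlim_comp _ _ _ _ _ _ _ _ Ha (filterlim_norm (V := C_NormedModule) l)).
  - exact Hb.
Qed.

(** Termwise differentiation at a point, from a summable quadratic Taylor
    remainder. *)
Lemma is_Cderive_Cseries (u : nat -> C -> C) (d : nat -> C) (c : nat -> R) (a : C) (r : R) :
  (0 < r)%R ->
  (forall y, (Cmod (y - a) < r)%R -> exists l, is_Cseries (fun k => u k y) l) ->
  (exists l, is_Cseries d l) -> ex_series c ->
  (forall k y, (Cmod (y - a) < r)%R ->
     (Cmod (u k y - u k a - (y - a) * d k) <= c k * Cmod (y - a) ^ 2)%R) ->
  is_Cderive (fun y => Cseries (fun k => u k y)) a (Cseries d).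
Proof.
  intros Hr Hu Hd%is_Cseries_Cseries [m Hc] H.
  apply is_Cderive_quadratic with r m; [exact Hr |].
  intros y Hy.
  assert (Ha : (Cmod (a - a) < r)%R)
    by (replace (a - a) with (RtoC 0) by ring; rewrite Cmod_0; exact Hr).
  apply Cmod_Cseries_le with (fun k => u k y - u k a - (y - a) * d k)
    (fun k => Cmod (y - a) ^ 2 * c k)%R.
  - intros k; rewrite (Rmult_comm _ (c k)); apply H, Hy.
  - apply is_Cseries_minus; [apply is_Cseries_minus |].
    + apply is_Cseries_Cseries, Hu, Hy.
    + apply is_Cseries_Cseries, Hu, Ha.
    + apply is_Cseries_scal, Hd.
  - rewrite (Rmult_comm m); exact (is_series_scal (V := R_NormedModule) _ c m Hc).
Qed.

Definition exp_coeff (x : C) (k : nat) : C := x ^ k / RtoC (INR (fact k)).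

Lemma RtoC_fact_neq_0 (k : nat) : RtoC (INR (fact k)) <> RtoC 0.
Proof. intros H%RtoC_inj; exact (INR_fact_neq_0 k H). Qed.

Lemma Cmod_exp_coeff (x : C) (k : nat) :
  Cmod (exp_coeff x k) = (Cmod x ^ k / INR (fact k))%R.
Proof.
  unfold exp_coeff; rewrite Cmod_div, Cmod_pow, Cmod_R by apply RtoC_fact_neq_0.
  rewrite Rabs_pos_eq by apply pos_INR; reflexivity.
Qed.

Lemma ex_series_exp_coeff (x : C) (q : R) :
  ex_series (fun k => Cmod (exp_coeff x k) * q ^ k)%R.
Proof.
  exists (exp (Cmod x * q)).
  apply is_series_ext with (2 := is_exp_Reals (Cmod x * q)).
  intros k; rewrite Cmod_exp_coeff, pow_n_pow, Rpow_mult_distr.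
  unfold scal; simpl; unfold mult; simpl; unfold Rdiv; ring.
Qed.

Lemma exp_coeff_succ (x : C) (k : nat) :
  RtoC (INR (S k)) * exp_coeff x (S k) = x * exp_coeff x k.
Proof.
  unfold exp_coeff; rewrite fact_simpl, mult_INR, RtoC_mult.
  simpl Cpow; field; split; [apply RtoC_fact_neq_0 |].
  intros H%RtoC_inj; exact (not_0_INR (S k) (Nat.neq_succ_0 k) H).
Qed.

(** * Inverse Pochhammer symbols on the half-plane [1 <= Re z] *)

Lemma Cmod_plus_nat_ge_1 (z : C) (k : nat) :
  (1 <= Re z)%R -> (1 <= Cmod (z + RtoC (INR k)))%R.
Proof.
  intros Hz; apply Rle_trans with (2 := Re_le_Cmod _).
  pose proof (pos_INR k); destruct z; simpl in *; lra.
Qed.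

Lemma plus_nat_neq_0 (z : C) (k : nat) :
  (1 <= Re z)%R -> z + RtoC (INR k) <> RtoC 0.
Proof. intros Hz; apply Cmod_gt_0; pose proof (Cmod_plus_nat_ge_1 z k Hz); lra. Qed.

Lemma Cmod_inv_plus_nat_le_1 (z : C) (k : nat) :
  (1 <= Re z)%R -> (Cmod (/ (z + RtoC (INR k))) <= 1)%R.
Proof.
  intros Hz; rewrite Cmod_inv by (apply plus_nat_neq_0, Hz).
  rewrite <- Rinv_1; apply Rinv_le_contravar; [lra | apply Cmod_plus_nat_ge_1, Hz].
Qed.

Lemma Cpochhammer_neq_0 (z : C) (k : nat) : (1 <= Re z)%R -> Cpochhammer z k <> RtoC 0.
Proof.
  intros Hz; induction k as [| k IH]; simpl.
  - intros H%RtoC_inj; lra.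
  - apply Cmult_neq_0; [exact IH | apply plus_nat_neq_0, Hz].
Qed.

Lemma Cmod_inv_Cpochhammer_le_1 (z : C) (k : nat) :
  (1 <= Re z)%R -> (Cmod (/ Cpochhammer z k) <= 1)%R.
Proof.
  intros Hz; induction k as [| k IH]; simpl.
  - rewrite Cmod_inv, Cmod_1 by (intros H%RtoC_inj; lra); lra.
  - rewrite Cinv_mult, Cmod_mult.
    pose proof (Cmod_inv_plus_nat_le_1 z k Hz).
    pose proof (Cmod_ge_0 (/ Cpochhammer z k)).
    pose proof (Cmod_ge_0 (/ (z + RtoC (INR k)))); nra.
Qed.

(** The derivative of [/ Cpochhammer z k] in [z]. *)
Fixpoint inv_Cpochhammer_deriv (z : C) (k : nat) : C :=
  match k with
  | O => RtoC 0
  | S j => inv_Cpochhammer_deriv z j / (z + RtoC (INR j))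
           - / Cpochhammer z j / ((z + RtoC (INR j)) * (z + RtoC (INR j)))
  end.

Lemma pow_2_ge_1 (k : nat) : (1 <= 2 ^ k)%R.
Proof. apply pow_R1_Rle; lra. Qed.

Lemma Cmod_inv_Cpochhammer_deriv_le (z : C) (k : nat) :
  (1 <= Re z)%R -> (Cmod (inv_Cpochhammer_deriv z k) <= 2 ^ k)%R.
Proof.
  intros Hz; induction k as [| k IH]; simpl.
  - rewrite Cmod_0; lra.
  - unfold Cminus, Cdiv; apply Rle_trans with (1 := Cmod_triangle _ _).
    rewrite Cmod_opp, Cinv_mult, !Cmod_mult.
    pose proof (Cmod_inv_plus_nat_le_1 z k Hz).
    pose proof (Cmod_inv_Cpochhammer_le_1 z k Hz).
    pose proof (Cmod_ge_0 (/ Cpochhammer z k)).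
    pose proof (Cmod_ge_0 (/ (z + RtoC (INR k)))).
    pose proof (Cmod_ge_0 (inv_Cpochhammer_deriv z k)).
    set (p := Cmod (/ Cpochhammer z k)) in *.
    set (q := Cmod (/ (z + RtoC (INR k)))) in *.
    assert (p * (q * q) <= 1)%R by (assert (0 <= q * q <= 1)%R by nra; nra).
    pose proof (pow_2_ge_1 k); nra.
Qed.

Lemma inv_Cpochhammer_lipschitz (a y : C) (k : nat) :
  (1 <= Re a)%R -> (1 <= Re y)%R ->
  (Cmod (/ Cpochhammer y k - / Cpochhammer a k) <= 2 ^ k * Cmod (y - a))%R.
Proof.
  intros Ha Hy; pose proof (Cmod_ge_0 (y - a)) as Hh.
  induction k as [| k IH]; simpl.
  - replace (/ RtoC 1 - / RtoC 1) with (RtoC 0) by ring; rewrite Cmod_0; lra.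
  - rewrite !Cinv_mult.
    pose proof (plus_nat_neq_0 a k Ha) as Na; pose proof (plus_nat_neq_0 y k Hy) as Ny.
    pose proof (Cmod_inv_plus_nat_le_1 a k Ha) as Qa.
    pose proof (Cmod_inv_plus_nat_le_1 y k Hy) as Qy.
    pose proof (Cmod_inv_Cpochhammer_le_1 a k Ha) as Pa.
    set (p := / Cpochhammer y k) in *; set (p0 := / Cpochhammer a k) in *.
    replace (p * / (y + RtoC (INR k)) - p0 * / (a + RtoC (INR k)))
      with ((p - p0) * / (y + RtoC (INR k))
            + p0 * (- (y - a) * (/ (y + RtoC (INR k)) * / (a + RtoC (INR k)))))
      by (field; auto).
    apply Rle_trans with (1 := Cmod_triangle _ _).
    rewrite !Cmod_mult, Cmod_opp.
    pose proof (Cmod_ge_0 p0); pose proof (Cmod_ge_0 (p - p0)).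
    set (qa := / (a + RtoC (INR k))) in *; set (qy := / (y + RtoC (INR k))) in *.
    pose proof (Cmod_ge_0 qa); pose proof (Cmod_ge_0 qy).
    assert (B1 : (Cmod (p - p0) * Cmod qy <= 2 ^ k * Cmod (y - a))%R) by nra.
    assert (B2 : (Cmod qy * Cmod qa <= 1)%R) by nra.
    assert (B3 : (Cmod (y - a) * (Cmod qy * Cmod qa) <= Cmod (y - a))%R) by nra.
    assert (B4 : (0 <= Cmod (y - a) * (Cmod qy * Cmod qa))%R)
      by (repeat apply Rmult_le_pos; assumption).
    pose proof (pow_2_ge_1 k); nra.
Qed.

(** In the inductive step the new factor [1 / (y + k)] is expanded around
    [1 / (a + k)], which costs the Lipschitz constant [2 ^ k] and a constant 1 on
    top of the previous remainder; [4 ^ k + 2 ^ k + 1 <= 4 ^ (k + 1)]. *)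
Lemma inv_Cpochhammer_taylor (a y : C) (k : nat) :
  (1 <= Re a)%R -> (1 <= Re y)%R ->
  (Cmod (/ Cpochhammer y k - / Cpochhammer a k - (y - a) * inv_Cpochhammer_deriv a k)
    <= 4 ^ k * Cmod (y - a) ^ 2)%R.
Proof.
  intros Ha Hy; pose proof (Cmod_ge_0 (y - a)) as Hh.
  induction k as [| k IH].
  - simpl; replace (/ RtoC 1 - / RtoC 1 - (y - a) * RtoC 0) with (RtoC 0) by ring.
    rewrite Cmod_0; nra.
  - pose proof (inv_Cpochhammer_lipschitz a y k Ha Hy) as L.
    change (4 ^ S k)%R with (4 * 4 ^ k)%R.
    change (Cpochhammer y (S k)) with (Cpochhammer y k * (y + RtoC (INR k))).
    change (Cpochhammer a (S k)) with (Cpochhammer a k * (a + RtoC (INR k))).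
    change (inv_Cpochhammer_deriv a (S k))
      with (inv_Cpochhammer_deriv a k / (a + RtoC (INR k))
            - / Cpochhammer a k / ((a + RtoC (INR k)) * (a + RtoC (INR k)))).
    rewrite !Cinv_mult.
    pose proof (plus_nat_neq_0 a k Ha) as Na; pose proof (plus_nat_neq_0 y k Hy) as Ny.
    pose proof (Cmod_inv_plus_nat_le_1 a k Ha) as Qa.
    pose proof (Cmod_inv_plus_nat_le_1 y k Hy) as Qy.
    pose proof (Cmod_inv_Cpochhammer_le_1 a k Ha) as Pa.
    set (p := / Cpochhammer y k) in *; set (p0 := / Cpochhammer a k) in *.
    set (d := inv_Cpochhammer_deriv a k) in *.
    set (qa := / (a + RtoC (INR k))) in *; set (qy := / (y + RtoC (INR k))) in *.
    assert (Eq : p * qy - p0 * qa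
              - (y - a) * (d / (a + RtoC (INR k))
                 - p0 / ((a + RtoC (INR k)) * (a + RtoC (INR k))))
            = (p - p0 - (y - a) * d) * qa + (- (p - p0) * ((y - a) * (qy * qa))
              + p0 * ((y - a) * (y - a) * (qy * (qa * qa))))).
    { unfold qa, qy; field; auto. }
    rewrite Eq; clear Eq.
    apply Rle_trans with (1 := Cmod_triangle _ _).
    apply Rle_trans with (1 := Rplus_le_compat_l _ _ _ (Cmod_triangle _ _)).
    rewrite !Cmod_mult, Cmod_opp.
    pose proof (Cmod_ge_0 p0); pose proof (Cmod_ge_0 (p - p0)).
    pose proof (Cmod_ge_0 qa); pose proof (Cmod_ge_0 qy).
    pose proof (Cmod_ge_0 (p - p0 - (y - a) * d)).
    set (h := Cmod (y - a)) in *.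
    assert (B2 : (0 <= Cmod qy * Cmod qa <= 1)%R) by nra.
    assert (B2' : (0 <= Cmod qa * Cmod qa <= 1)%R) by nra.
    assert (B3 : (0 <= Cmod qy * (Cmod qa * Cmod qa) <= 1)%R) by nra.
    assert (T1 : (Cmod (p - p0 - (y - a) * d) * Cmod qa <= 4 ^ k * h ^ 2)%R) by nra.
    assert (T2 : (Cmod (p - p0) * (h * (Cmod qy * Cmod qa)) <= 2 ^ k * h ^ 2)%R).
    { apply Rle_trans with (2 ^ k * h * h)%R; [| right; ring].
      apply Rmult_le_compat; [assumption | apply Rmult_le_pos; lra | exact L | nra]. }
    assert (T3 : (Cmod p0 * (h * h * (Cmod qy * (Cmod qa * Cmod qa))) <= h ^ 2)%R).
    { assert (0 <= h * h * (Cmod qy * (Cmod qa * Cmod qa)) <= h * h)%R by nra.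
      nra. }
    assert (K2 : (2 ^ k <= 4 ^ k)%R) by (apply pow_incr; lra).
    pose proof (pow_2_ge_1 k).
    assert (0 <= h ^ 2)%R by apply pow2_ge_0.
    nra.
Qed.

(** * The Wright function of first parameter 1 *)

Definition Wright_term (x b : C) (k : nat) : C := exp_coeff x k * rGamma (b + RtoC (INR k)).

Lemma Wright_1 (b x : C) : Wright (RtoC 1) b x = Cseries (Wright_term x b).
Proof.
  apply Cseries_ext; intros k; unfold Wright_term, exp_coeff.
  replace (RtoC 1 * RtoC (INR k) + b) with (b + RtoC (INR k)) by ring; reflexivity.
Qed.

Lemma rGamma_Cpochhammer (b : C) (k : nat) :
  rGamma b = Cpochhammer b k * rGamma (b + RtoC (INR k)).
Proof.
  induction k as [| k IH].
  - simpl; rewrite Cplus_0_r; ring.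
  - rewrite IH, rGamma_succ, S_INR, RtoC_plus, Cplus_assoc; simpl; ring.
Qed.

Lemma Wright_term_Cpochhammer (x b : C) (k : nat) :
  (1 <= Re b)%R -> Wright_term x b k = rGamma b * (exp_coeff x k * / Cpochhammer b k).
Proof.
  intros Hb; unfold Wright_term.
  rewrite (rGamma_Cpochhammer b k); field; apply Cpochhammer_neq_0, Hb.
Qed.

Lemma ex_Cseries_inv_Cpochhammer (x b : C) :
  (1 <= Re b)%R -> exists l, is_Cseries (fun k => exp_coeff x k * / Cpochhammer b k) l.
Proof.
  intros Hb; apply ex_Cseries_le with (2 := ex_series_exp_coeff x 1).
  intros k; rewrite pow1, Cmod_mult.
  apply Rmult_le_compat_l; [apply Cmod_ge_0 | apply Cmod_inv_Cpochhammer_le_1, Hb].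
Qed.

(** The functional equation [1 / Gamma(s) = s / Gamma(s + 1)] applied to every
    term, with the factor [b + k] split. *)
Lemma is_Cseries_Wright_rec (x b l m : C) :
  is_Cseries (Wright_term x (b + RtoC 1)) l -> is_Cseries (Wright_term x (b + RtoC 2)) m ->
  is_Cseries (Wright_term x b) (b * l + x * m).
Proof.
  intros Hl Hm.
  pose (v := fun k => RtoC (INR k) * exp_coeff x k * rGamma (b + RtoC 1 + RtoC (INR k))).
  assert (Hv : is_Cseries v (x * m)).
  { apply is_series_decr_1.
    change (is_Cseries (fun k => v (S k)) (x * m + - v 0%nat)).
    replace (x * m + - v 0%nat) with (x * m) by (unfold v; simpl; ring).
    apply (is_Cseries_ext (fun k => x * Wright_term x (b + RtoC 2) k)).
    - intros k; unfold v, Wright_term.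
      rewrite exp_coeff_succ, S_INR, RtoC_plus.
      replace (b + RtoC 1 + (RtoC (INR k) + RtoC 1)) with (b + RtoC 2 + RtoC (INR k)); [ring |].
      replace (RtoC 2) with (RtoC 1 + RtoC 1) by (rewrite <- RtoC_plus; f_equal; ring); ring.
    - apply is_Cseries_scal, Hm. }
  apply (is_Cseries_ext
           (fun k => b * Wright_term x (b + RtoC 1) k + v k)).
  - intros k; unfold v, Wright_term; rewrite (rGamma_succ (b + RtoC (INR k))).
    replace (b + RtoC (INR k) + RtoC 1) with (b + RtoC 1 + RtoC (INR k)) by ring.
    change (b * (exp_coeff x k * rGamma (b + RtoC 1 + RtoC (INR k)))
        + RtoC (INR k) * exp_coeff x k * rGamma (b + RtoC 1 + RtoC (INR k))
      = exp_coeff x k * ((b + RtoC (INR k)) * rGamma (b + RtoC 1 + RtoC (INR k)))); ring.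
  - apply is_Cseries_plus; [apply is_Cseries_scal, Hl | exact Hv].
Qed.

(** On [1 <= Re b] the series is dominated by the exponential series; the
    recurrence then moves convergence one unit to the left at a time. *)
Lemma ex_Cseries_Wright (x b : C) : exists l, is_Cseries (Wright_term x b) l.
Proof.
  assert (H : forall n b, (1 <= Re b + INR n)%R -> exists l, is_Cseries (Wright_term x b) l).
  { clear b; intros n; induction n as [| n IH]; intros b Hb.
    - simpl in Hb; rewrite Rplus_0_r in Hb.
      destruct (ex_Cseries_inv_Cpochhammer x b Hb) as [l Hl].
      exists (rGamma b * l).
      apply is_Cseries_ext with (2 := is_Cseries_scal (rGamma b) _ _ Hl).
      intros k; symmetry; apply Wright_term_Cpochhammer, Hb.
    - rewrite S_INR in Hb.
      destruct (IH (b + RtoC 1)) as [l Hl]; [destruct b; simpl in *; lra |].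
      destruct (IH (b + RtoC 2)) as [m Hm]; [destruct b; simpl in *; lra |].
      exists (b * l + x * m); apply is_Cseries_Wright_rec; assumption. }
  destruct (archimed (1 - Re b)) as [A _].
  apply (H (Z.to_nat (up (1 - Re b)))).
  rewrite INR_IZR_INZ.
  assert (up (1 - Re b) <= Z.of_nat (Z.to_nat (up (1 - Re b))))%Z as B by lia.
  apply IZR_le in B; lra.
Qed.

Lemma Wright_1_rec (x b : C) :
  Wright (RtoC 1) b x
  = b * Wright (RtoC 1) (b + RtoC 1) x + x * Wright (RtoC 1) (b + RtoC 2) x.
Proof.
  rewrite !Wright_1; apply Cseries_eq, is_Cseries_Wright_rec;
    apply is_Cseries_Cseries, ex_Cseries_Wright.
Qed.

Lemma is_Cderive_Wright_nat (x : C) (n : nat) :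
  exists l, is_Cderive (fun b => Wright (RtoC 1) b x) (RtoC (INR (S (S n)))) l.
Proof.
  set (a := RtoC (INR (S (S n)))).
  assert (Ha : (2 <= Re a)%R).
  { change (2 <= INR (S (S n)))%R; rewrite !S_INR; pose proof (pos_INR n); lra. }
  assert (Hy : forall y, (Cmod (y - a) < 1)%R -> (1 <= Re y)%R).
  { intros y Hy; pose proof (re_le_Cmod (y - a)) as A; apply Rabs_le_between in A.
    assert (Re y = Re (y - a) + Re a)%R by (destruct y, a; simpl; ring); lra. }
  destruct (is_Cderive_rGamma_nat n) as [l Hl]; fold a in Hl.
  assert (D : is_Cderive (fun y => Cseries (fun k => exp_coeff x k * / Cpochhammer y k)) a
                (Cseries (fun k => exp_coeff x k * inv_Cpochhammer_deriv a k))).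
  { apply is_Cderive_Cseries with (fun k => Cmod (exp_coeff x k) * 4 ^ k)%R 1%R.
    - lra.
    - intros y By; apply ex_Cseries_inv_Cpochhammer, Hy, By.
    - apply ex_Cseries_le with (2 := ex_series_exp_coeff x 2).
      intros k; rewrite Cmod_mult; apply Rmult_le_compat_l; [apply Cmod_ge_0 |].
      apply Cmod_inv_Cpochhammer_deriv_le; lra.
    - apply ex_series_exp_coeff.
    - intros k y By.
      replace (exp_coeff x k * / Cpochhammer y k - exp_coeff x k * / Cpochhammer a k
               - (y - a) * (exp_coeff x k * inv_Cpochhammer_deriv a k))
        with (exp_coeff x k *
               (/ Cpochhammer y k - / Cpochhammer a k - (y - a) * inv_Cpochhammer_deriv a k))
        by ring.
      rewrite Cmod_mult, Rmult_assoc; apply Rmult_le_compat_l; [apply Cmod_ge_0 |].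
      apply inv_Cpochhammer_taylor; [lra | apply Hy, By]. }
  eexists; apply is_Cderive_ext_loc with
    (fun y => rGamma y * Cseries (fun k => exp_coeff x k * / Cpochhammer y k)) 1%R;
    [lra | | exact (is_Cderive_mult _ _ a _ _ Hl D)].
  intros y By; rewrite Wright_1; symmetry; apply Cseries_eq.
  apply (is_Cseries_ext
    (fun k => rGamma y * (exp_coeff x k * / Cpochhammer y k))).
  - intros k; symmetry; apply Wright_term_Cpochhammer, Hy, By.
  - apply is_Cseries_scal, is_Cseries_Cseries, ex_Cseries_inv_Cpochhammer, Hy, By.
Qed.

Lemma is_Cderive_Wright_rec (x a l m : C) :
  is_Cderive (fun b => Wright (RtoC 1) b x) (a + RtoC 1) l ->
  is_Cderive (fun b => Wright (RtoC 1) b x) (a + RtoC 2) m ->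
  is_Cderive (fun b => Wright (RtoC 1) b x) a
    (Wright (RtoC 1) (a + RtoC 1) x + a * l + x * m).
Proof.
  intros Hl Hm.
  apply is_Cderive_ext_loc with (fun b => b * Wright (RtoC 1) (b + RtoC 1) x
                                   + x * Wright (RtoC 1) (b + RtoC 2) x) 1%R.
  - lra.
  - intros y _; symmetry; apply Wright_1_rec.
  - apply is_Cderive_plus.
    + apply is_Cderive_eq with (RtoC 1 * Wright (RtoC 1) (a + RtoC 1) x + a * l); [| ring].
      apply (is_Cderive_mult (fun b => b) (fun b => Wright (RtoC 1) (b + RtoC 1) x));
        [apply is_Cderive_id |].
      exact (is_Cderive_shift (fun b => Wright (RtoC 1) b x) (RtoC 1) a l Hl).
    + apply is_Cderive_scal.
      exact (is_Cderive_shift (fun b => Wright (RtoC 1) b x) (RtoC 2) a m Hm).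
Qed.

Lemma is_Cderive_Wright_2_0 (x : C) :
  exists l, is_Cderive (fun b => Wright (RtoC 1) b x) (RtoC 2) l /\
    is_Cderive (fun b => Wright (RtoC 1) b x) (RtoC 0) (Wright (RtoC 1) (RtoC 1) x + x * l).
Proof.
  destruct (is_Cderive_Wright_nat x 0) as [l2 H2].
  destruct (is_Cderive_Wright_nat x 1) as [l3 H3].
  replace (RtoC (INR 2)) with (RtoC 2) in H2 by (f_equal; simpl; ring).
  replace (RtoC (INR 3)) with (RtoC 3) in H3 by (f_equal; simpl; ring).
  exists l2; split; [exact H2 |].
  assert (H1 : is_Cderive (fun b => Wright (RtoC 1) b x) (RtoC 1)
                 (Wright (RtoC 1) (RtoC 1 + RtoC 1) x + RtoC 1 * l2 + x * l3)).
  { apply is_Cderive_Wright_rec; rewrite <- RtoC_plus.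
    - replace (1 + 1)%R with 2%R by ring; exact H2.
    - replace (1 + 2)%R with 3%R by ring; exact H3. }
  pose proof (is_Cderive_Wright_rec x (RtoC 0)
                (Wright (RtoC 1) (RtoC 1 + RtoC 1) x + RtoC 1 * l2 + x * l3) l2) as H0.
  rewrite !Cplus_0_l in H0.
  apply is_Cderive_eq with (1 := H0 H1 H2); ring.
Qed.

(** * Bessel functions *)

Lemma BesselI_Wright (x : R) (nu : C) :
  x <> 0%R ->
  BesselI nu (RtoC 2 * Csqrt (RtoC x))
  = Cexp (nu * Clog (Csqrt (RtoC x))) * Wright (RtoC 1) (nu + RtoC 1) (RtoC x).
Proof.
  intros Hx; unfold BesselI, Cpower.
  assert (H2 : RtoC 2 <> RtoC 0) by (intros H%RtoC_inj; lra).
  replace (RtoC 2 * Csqrt (RtoC x) / RtoC 2) with (Csqrt (RtoC x)) by (field; exact H2).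
  assert (Hz : (RtoC 2 * Csqrt (RtoC x)) ^ 2 / RtoC 4 = RtoC x).
  { rewrite <- (Csqrt_mul_self x Hx) at 2.
    replace (RtoC 4) with (RtoC 2 * RtoC 2) by (rewrite <- RtoC_mult; f_equal; ring).
    simpl Cpow; field; exact H2. }
  rewrite Wright_1; apply (f_equal (Cmult _)), Cseries_ext; intros k.
  unfold Wright_term, exp_coeff; rewrite Hz.
  replace (nu + RtoC (INR k) + RtoC 1) with (nu + RtoC 1 + RtoC (INR k)) by ring.
  reflexivity.
Qed.

Lemma Proper_locally'_C (a : C) : ProperFilter' (locally' (T := C_UniformSpace) a).
Proof.
  split.
  - intros [eps H].
    apply (H (a + RtoC (eps / 2))).
    + apply (C_NormedModule_mixin_compat1 a (a + RtoC (eps / 2)) eps).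
      change (Cmod (a + RtoC (eps / 2) - a) < eps)%R.
      replace (a + RtoC (eps / 2) - a) with (RtoC (eps / 2)) by ring.
      pose proof (cond_pos eps); rewrite Cmod_R, Rabs_pos_eq; lra.
    + intros E.
      assert (E' : RtoC (eps / 2) = RtoC 0).
      { replace (RtoC (eps / 2)) with (a + RtoC (eps / 2) - a) by ring.
        rewrite E; ring. }
      apply RtoC_inj in E'; pose proof (cond_pos eps); lra.
  - apply within_filter, locally_filter.
Qed.

Lemma Cexp_Ci_PI : Cexp (Ci * RtoC PI) = - RtoC 1.
Proof.
  unfold Cexp, Ci, Re, Im; simpl.
  replace (0 * PI - 1 * 0)%R with 0%R by ring.
  replace (0 * 0 + 1 * PI)%R with PI by ring.
  rewrite exp_0, cos_PI, sin_PI; apply injective_projections; simpl; ring.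
Qed.

Lemma Cexp_opp_Ci_PI : Cexp (- (Ci * RtoC PI)) = - RtoC 1.
Proof.
  pose proof (Cexp_opp_l (Ci * RtoC PI)) as H; rewrite Cexp_Ci_PI in H.
  rewrite <- H; ring.
Qed.

Lemma Ci_neq_0 : Ci <> RtoC 0.
Proof. intros H; apply (f_equal snd) in H; simpl in H; lra. Qed.

Lemma Csin_PI : Csin (RtoC 1 * RtoC PI) = RtoC 0.
Proof.
  unfold Csin; rewrite Cmult_1_l, Cexp_Ci_PI, Cexp_opp_Ci_PI; unfold Cdiv; ring.
Qed.

Lemma is_Cderive_Csin_PI :
  is_Cderive (fun mu => Csin (mu * RtoC PI)) (RtoC 1) (- RtoC PI).
Proof.
  assert (H2 : RtoC 2 <> RtoC 0) by (intros H%RtoC_inj; lra).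
  pose (c := Ci * RtoC PI).
  (* constant factors to the left, where [is_Cderive_scal] expects them *)
  apply is_Cderive_ext_loc with
    (fun mu => / (RtoC 2 * Ci) * (Cexp (c * mu) - Cexp (- c * mu))) 1%R; [lra | |].
  - intros y _; unfold Csin, c, Cdiv; rewrite (Cmult_comm _ (/ (RtoC 2 * Ci))).
    replace (Ci * (y * RtoC PI)) with (Ci * RtoC PI * y) by ring.
    replace (- (Ci * RtoC PI * y)) with (- (Ci * RtoC PI) * y) by ring.
    reflexivity.
  - assert (L : forall u, is_Cderive (fun mu => u * mu) (RtoC 1) u).
    { intros u; apply is_Cderive_eq with (u * RtoC 1); [| ring].
      apply is_Cderive_scal, is_Cderive_id. }
    apply is_Cderive_eq with
      (/ (RtoC 2 * Ci) * (c * Cexp (c * RtoC 1) - - c * Cexp (- c * RtoC 1))).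
    + apply is_Cderive_scal, is_Cderive_minus; apply is_Cderive_Cexp_comp, L.
    + rewrite !Cmult_1_r; unfold c; rewrite Cexp_Ci_PI, Cexp_opp_Ci_PI.
      field; exact Ci_neq_0.
Qed.

(** L'Hopital's rule for the quotient that defines [K] at order 1. *)
Lemma BesselK_1 (z l : C) :
  is_Cderive (fun mu => BesselI (- mu) z - BesselI mu z) (RtoC 1) l ->
  BesselI (- RtoC 1) z = BesselI (RtoC 1) z ->
  BesselK (RtoC 1) z = - l / RtoC 2.
Proof.
  intros Hl H0; unfold BesselK.
  destruct (Ceq_dec (Csin (RtoC 1 * RtoC PI)) (RtoC 0)) as [_ | n];
    [| exfalso; exact (n Csin_PI)].
  assert (H2 : RtoC 2 <> RtoC 0) by (intros H%RtoC_inj; lra).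
  assert (HPI : RtoC PI <> RtoC 0) by (intros H%RtoC_inj; exact (PI_neq0 H)).
  apply (iota_filterlim_locally (V := C_CompleteNormedModule)
           (FF := Proper_locally'_C (RtoC 1))).
  apply filterlim_ext with (fun mu =>
    RtoC (PI / 2) * (BesselI (- mu) z - BesselI mu z) / Csin (mu * RtoC PI)).
  - intros mu; unfold BesselK_quotient, Cdiv; ring.
  - replace (- l / RtoC 2) with (RtoC (PI / 2) * l / - RtoC PI)
      by (rewrite RtoC_div by lra; field; auto).
    apply (filterlim_quotient_of_derive
             (fun mu => RtoC (PI / 2) * (BesselI (- mu) z - BesselI mu z))
             (fun mu => Csin (mu * RtoC PI))).
    + apply is_Cderive_scal, Hl.
    + exact is_Cderive_Csin_PI.
    + rewrite H0; ring.
    + exact Csin_PI.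
    + intros H; apply HPI; replace (RtoC PI) with (- - RtoC PI) by ring; rewrite H; ring.
Qed.

Theorem theorem6p3 (x : R) (hx : x <> 0%R) :
  is_derive (K := C_AbsRing) (V := C_NormedModule)
    (fun beta : C => Wright (RtoC 1) beta (RtoC x)) (RtoC 2)
    ((RtoC 2 * BesselK (RtoC 1) (RtoC 2 * Csqrt (RtoC x))
        - Clog (RtoC x) * BesselI (RtoC 1) (RtoC 2 * Csqrt (RtoC x)))
       / (RtoC 2 * Csqrt (RtoC x))
     - BesselI (RtoC 0) (RtoC 2 * Csqrt (RtoC x)) / (RtoC 2 * RtoC x)).
Proof.
  destruct (is_Cderive_Wright_2_0 (RtoC x)) as [D [D2 D0]].
  set (W := fun b => Wright (RtoC 1) b (RtoC x)) in *.
  set (s := Csqrt (RtoC x)) in *; set (L := Clog s).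
  assert (Hs : Cexp L = s) by (apply Cexp_Clog_Csqrt, hx).
  assert (Hs0 : s <> RtoC 0) by (rewrite <- Hs; apply Cexp_neq_0).
  assert (Hsx : RtoC x = s * s) by (symmetry; apply Csqrt_mul_self, hx).
  assert (Hsi : Cexp (- L) = / s).
  { pose proof (Cexp_opp_l L) as E; rewrite Hs in E.
    replace (/ s) with (Cexp (- L) * s * / s) by (rewrite E; ring).
    field; exact Hs0. }
  assert (H2 : RtoC 2 <> RtoC 0) by (intros H%RtoC_inj; lra).
  assert (HL : Clog (RtoC x) = RtoC 2 * L).
  { unfold L, s; rewrite Clog_Csqrt by exact hx; field; exact H2. }
  assert (HI : forall nu, BesselI nu (RtoC 2 * s) = Cexp (nu * L) * W (nu + RtoC 1))
    by (intros nu; unfold W, L, s; exact (BesselI_Wright x nu hx)).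
  assert (W0 : W (RtoC 0) = s * s * W (RtoC 2)).
  { unfold W; rewrite Wright_1_rec, !Cplus_0_l, Hsx; ring. }
  assert (E2 : RtoC 1 + RtoC 1 = RtoC 2) by (rewrite <- RtoC_plus; f_equal; ring).
  assert (E0 : - RtoC 1 + RtoC 1 = RtoC 0) by ring.
  assert (I1 : BesselI (RtoC 1) (RtoC 2 * s) = s * W (RtoC 2))
    by (rewrite HI, Cmult_1_l, Hs, E2; reflexivity).
  assert (Im1 : BesselI (- RtoC 1) (RtoC 2 * s) = s * W (RtoC 2)).
  { rewrite HI, E0, W0.
    replace (- RtoC 1 * L) with (- L) by ring; rewrite Hsi; field; exact Hs0. }
  assert (DI : is_Cderive (fun mu => BesselI (- mu) (RtoC 2 * s) - BesselI mu (RtoC 2 * s))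
                 (RtoC 1)
                 ((- L * / s * (s * s * W (RtoC 2)) - / s * (W (RtoC 1) + s * s * D))
                  - (L * s * W (RtoC 2) + s * D))).
  { apply is_Cderive_ext_loc with (fun mu =>
      Cexp (- L * mu) * W (- RtoC 1 * mu + RtoC 1) - Cexp (L * mu) * W (mu + RtoC 1)) 1%R.
    - lra.
    - intros y _; rewrite !HI.
      replace (- L * y) with (- y * L) by ring.
      replace (L * y) with (y * L) by ring.
      replace (- RtoC 1 * y + RtoC 1) with (- y + RtoC 1) by ring.
      reflexivity.
    - assert (Lin : forall u, is_Cderive (fun mu => u * mu) (RtoC 1) u).
      { intros u; apply is_Cderive_eq with (u * RtoC 1); [| ring].
        apply is_Cderive_scal, is_Cderive_id. }
      assert (A : is_Cderive (fun mu => W (- RtoC 1 * mu + RtoC 1)) (RtoC 1)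
                    (- RtoC 1 * (W (RtoC 1) + RtoC x * D))).
      { apply (is_Cderive_comp W (fun mu => - RtoC 1 * mu + RtoC 1)).
        - rewrite Cmult_1_r, E0; exact D0.
        - apply is_Cderive_eq with (- RtoC 1 + RtoC 0); [| ring].
          apply is_Cderive_plus; [apply Lin | apply is_Cderive_const]. }
      assert (B : is_Cderive (fun mu => W (mu + RtoC 1)) (RtoC 1) D)
        by (apply is_Cderive_shift; rewrite E2; exact D2).
      apply is_Cderive_eq with (1 := is_Cderive_minus _ _ _ _ _
        (is_Cderive_mult _ _ _ _ _ (is_Cderive_Cexp_comp _ _ _ (Lin (- L))) A)
        (is_Cderive_mult _ _ _ _ _ (is_Cderive_Cexp_comp _ _ _ (Lin L)) B)).
      rewrite !Cmult_1_r, E0, E2, Hs, Hsi, W0, Hsx; ring. }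
  rewrite (BesselK_1 _ _ DI) by (rewrite I1, Im1; reflexivity).
  rewrite I1, HI, Cmult_0_l, Cexp_0, Cplus_0_l, HL, Hsx.
  (* the ascription to [C] is what lets [field] find the field structure *)
  match goal with |- is_derive _ _ ?v =>
    enough (E : @eq C v D) by (rewrite E; exact D2)
  end.
  field; auto.
Qed.
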